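(* Let $A\in\mathbb{R}^{n\times n}$, $B\in\mathbb{R}^{n\times m}$ with $(A,B)$ stabilizable, let $Q\in\mathbb{R}^{n\times n}$ and $R\in\mathbb{R}^{m\times m}$ be symmetric positive definite, let $\mathcal{G}=\{K\in\mathbb{R}^{m\times n}: A-BK\text{ is Hurwitz}\}$ and $\mathcal{J}_2(K)=\mathrm{Tr}(P_K)$ for $K\in\mathcal{G}$, where $P_K$ solves $(A-BK)^\top P_K+P_K(A-BK)+Q+K^\top RK=0$. Define $$L(h)=\frac{2\|R\|}{\lambda_{\min}(Q)}h+\frac{8a_2\|B\|\|R\|}{\lambda_{\min}(Q)^2}h^{5/2}+\frac{8\|B\|(a_1\|R\|+\|B\|)}{\lambda_{\min}(Q)^2}h^3,$$ with $a_1=\frac{2\|B\|}{\lambda_{\min}(R)}$ and $a_2=\big(\frac{2\|A\|}{\lambda_{\min}(R)}\big)^{1/2}$. If $0<\eta(k)\le\frac{1}{L(\mathcal{J}_2(K(k)))}$, then the standard gradient descent algorithm $$K(k+1)=K(k)-\eta(k)\big(\nabla\mathcal{J}_2(K(k))+W(k)\big)=K(k)-\eta(k)\big(2(RK(k)-B^\top P_{K(k)})Y_{K(k)}+W(k)\big)$$ is small-disturbance input-to-state stable with respect to $W\in\ell_\infty^{m\times n}$.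
   Context: $\|\cdot\|$ is the spectral norm of a matrix, $\|\cdot\|_F$ the Frobenius norm, $\lambda_{\min}$ the smallest eigenvalue. $\mathbb{R}_+=[0,\infty)$; $\mathbb{Z}_+$ is the set of nonnegative integers. $\ell_\infty^{m\times n}$ is the set of bounded functions $W:\mathbb{Z}_+\to\mathbb{R}^{m\times n}$ with $\|W\|_\infty=\sup_k\|W(k)\|_F$. LQR objects. For $K\in\mathcal{G}$, $Y_K$ is the solution of $(A-BK)Y_K+Y_K(A-BK)^\top+I_n=0$, and $\nabla\mathcal{J}_2(K)=2(RK-B^\top P_K)Y_K$. The optimal gain is $K^*=R^{-1}B^\top P^*$, where $P^*$ is the symmetric positive definite solution of $A^\top P^*+P^*A+Q-P^*BR^{-1}B^\top P^*=0$; $K^*$ minimizes $\mathcal{J}_2$ over $\mathcal{G}$. Comparison functions. $\alpha:\mathbb{R}_+\to\mathbb{R}_+$ is a $\mathcal{K}$-function if it is continuous, strictly increasing and $\alpha(0)=0$. For $d\in(0,\infty]$, $\alpha:[0,d)\to\mathbb{R}_+$ is a $\mathcal{K}_{[0,d)}$-function if it is continuous, strictly increasing and $\alpha(0)=0$. $\beta:\mathbb{R}_+\times\mathbb{R}_+\to\mathbb{R}_+$ is a $\mathcal{KL}$-function if $\beta(\cdot,t)$ is a $\mathcal{K}$-function for each fixed $t\ge0$ and, for each fixed $r\ge0$, $\beta(r,\cdot)$ is decreasing (in the non-strict sense) and tends to $0$ as $t\to\infty$. Size function. $\mathcal{V}:\mathcal{G}\to\mathbb{R}_+$ is a size function for $(\mathcal{G},K^*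 )$ if it is continuous; positive definite with respect to $K^*$ ($\mathcal{V}(K^* )=0$, $\mathcal{V}(K)>0$ for $K\ne K^*$); and coercive (for any sequence $\{K_k\}$ in $\mathcal{G}$ with $K_k\to\partial\mathcal{G}$ or $\|K_k\|_F\to\infty$, $\mathcal{V}(K_k)\to\infty$). Small-disturbance ISS. The algorithm (a discrete-time system with state $K(k)\in\mathcal{G}$, equilibrium $K^*$ and disturbance $W$) is small-disturbance input-to-state stable with respect to $W$ if there exist a size function $\mathcal{V}$ for $(\mathcal{G},K^* )$, a constant $d>0$ (possibly $\infty$), a $\mathcal{KL}$-function $\beta$ and a $\mathcal{K}_{[0,d)}$-function $\gamma$ such that for all $W$ with $\|W\|_\infty<d$ and all $K(0)\in\mathcal{G}$, $K(k)$ remains in $\mathcal{G}$ and $\mathcal{V}(K(k))\le\beta(\mathcal{V}(K(0)),k)+\gamma(\|W\|_\infty)$ for all $k\in\mathbb{Z}_+$.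
   Formalization: The step size is a function of k and K(k); for each h it is also assumed bounded below, uniformly over gains with J_2(K) ≤ h, by a sequence with divergent sum. Without this the claim fails: summable steps such as min(c·2^{-k}, 1/L) stall away from K*. *)

(* Defs.v *)
From HB Require Import structures.
From mathcomp Require Export all_boot all_order all_algebra.
From mathcomp Require Export complex.
From mathcomp Require Export all_classical all_reals all_analysis.
Export Order.TTheory GRing.Theory Num.Theory numFieldNormedType.Exports.

Set Implicit Arguments.
Unset Strict Implicit.
Unset Printing Implicit Defensive.

Local Open Scope classical_set_scope.
Local Open Scope ring_scope.

(* The library norm on matrices is the entrywise maximum; it induces the same
   topology as the Frobenius norm, so the library topology is used below. *)
Definition frobenius (F : realType) (m n : nat) (M : 'M[F]_(m, n)) : F :=
  Num.sqrt (\sum_i \sum_j M i j ^+ 2).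

(* On column vectors [frobenius] is the Euclidean norm. *)
Definition spectral_norm (F : realType) (m n : nat) (M : 'M[F]_(m, n)) : F :=
  sup [set frobenius (M *m x) | x in [set x : 'cV[F]_n | frobenius x <= 1]].

(* Used for symmetric M of positive size only, where the set of (real)
   eigenvalues is finite and nonempty, so that the infimum is a minimum. *)
Definition lambda_min (F : realType) (n : nat) (M : 'M[F]_n) : F :=
  inf [set l : F | eigenvalue M l].

Definition sym_posdef (F : realType) (n : nat) (M : 'M[F]_n) : Prop :=
  M^T = M /\ forall x : 'cV[F]_n, x != 0 -> 0 < (x^T *m M *m x) 0 0.

Definition hurwitz (F : realType) (n : nat) (M : 'M[F]_n) : Prop :=
  forall z : F[i], eigenvalue (map_mx (real_complex F) M) z -> complex.Re z < 0.

Definition stabilizable (F : realType) (n m : nat)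
    (A : 'M[F]_n) (B : 'M[F]_(n, m)) : Prop :=
  exists K : 'M[F]_(m, n), hurwitz (A - B *m K).

Definition stabilizing_gains (F : realType) (n m : nat)
    (A : 'M[F]_n) (B : 'M[F]_(n, m)) : set 'M[F]_(m, n) :=
  [set K | hurwitz (A - B *m K)].

(* The solution X of M^T X + X M + N = 0, which is unique when M is Hurwitz
   (the only case of interest); the value is 0 if there is no solution. *)
Definition lyapunov_sol (F : realType) (n : nat) (M N : 'M[F]_n) : 'M[F]_n :=
  xget 0 [set X | M^T *m X + X *m M + N = 0].

Section LQR.
Variables (F : realType) (n m : nat).
Variables (A : 'M[F]_n) (B : 'M[F]_(n, m)) (Q : 'M[F]_n) (R : 'M[F]_m).

Definition lqr_P (K : 'M[F]_(m, n)) : 'M[F]_n :=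
  lyapunov_sol (A - B *m K) (Q + K^T *m R *m K).

Definition lqr_Y (K : 'M[F]_(m, n)) : 'M[F]_n :=
  lyapunov_sol (A - B *m K)^T 1%:M.

Definition lqr_J (K : 'M[F]_(m, n)) : F := \tr (lqr_P K).

Definition lqr_grad (K : 'M[F]_(m, n)) : 'M[F]_(m, n) :=
  2 *: ((R *m K - B^T *m lqr_P K) *m lqr_Y K).

(* The symmetric positive definite solution of the algebraic Riccati equation;
   it exists and is unique when (A, B) is stabilizable and Q, R are symmetric
   positive definite. *)
Definition riccati_sol : 'M[F]_n :=
  xget 0 [set P | sym_posdef P /\
    A^T *m P + P *m A + Q - P *m B *m invmx R *m B^T *m P = 0].

Definition lqr_opt_gain : 'M[F]_(m, n) := invmx R *m B^T *m riccati_sol.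

Definition lqr_L (h : F) : F :=
  let a1 := 2 * spectral_norm B / lambda_min R in
  let a2 := Num.sqrt (2 * spectral_norm A / lambda_min R) in
  2 * spectral_norm R / lambda_min Q * h
  + 8 * a2 * spectral_norm B * spectral_norm R / lambda_min Q ^+ 2
    * h `^ (5 / 2)
  + 8 * spectral_norm B * (a1 * spectral_norm R + spectral_norm B)
    / lambda_min Q ^+ 2 * h ^+ 3.

End LQR.

Definition ico0 (F : realType) (d : \bar F) : set F :=
  [set r | 0 <= r /\ (r%:E < d)%E].

(* Comparison functions are total functions of which only the values on the
   stated domain matter; nonnegativity there follows from the other clauses.
   A K-function is the case d = +oo. *)
Definition classKd (F : realType) (d : \bar F) (f : F -> F) : Prop :=
  [/\ {within ico0 d, continuous f},
      forall r s, ico0 d r -> ico0 d s -> r < s -> f r < f s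
    & f 0 = 0].

Definition classK (F : realType) (f : F -> F) : Prop := classKd +oo%E f.

Definition classKL (F : realType) (beta : F -> F -> F) : Prop :=
  (forall t, 0 <= t -> classK (beta ^~ t)) /\
  (forall r, 0 <= r ->
    (forall s t, 0 <= s -> s <= t -> beta r t <= beta r s) /\
    beta r t @[t --> +oo] --> 0).

Section SmallDisturbanceISS.
Variables (F : realType) (m n : nat).
Local Notation M := 'M[F]_(m, n).

Definition boundary (G : set M) : set M := closure G `\` interior G.

Definition tends_to_set (K : nat -> M) (S : set M) : Prop :=
  forall e : F, 0 < e ->
    \forall k \near \oo, exists2 X, S X & frobenius (K k - X) < e.

(* V is only meaningful on G. *)
Definition size_function (G : set M) (Ks : M) (V : M -> F) : Prop :=
  [/\ {within G, continuous V},
      G Ks /\ V Ks = 0,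
      forall K, G K -> K != Ks -> 0 < V K
    & forall K : nat -> M, (forall k, G (K k)) ->
        tends_to_set K (boundary G) \/ frobenius (K k) @[k --> \oo] --> +oo ->
        V (K k) @[k --> \oo] --> +oo].

Definition in_linf (W : nat -> M) : Prop :=
  exists c : F, forall k, frobenius (W k) <= c.

Definition linf_norm (W : nat -> M) : F := sup (range (fun k => frobenius (W k))).

(* The system is K(k+1) = f k (K(k)) (W(k)) with state space G and
   equilibrium Ks; the values of f for K outside G are irrelevant. *)
Definition small_disturbance_ISS (G : set M) (Ks : M)
    (f : nat -> M -> M -> M) : Prop :=
  exists (V : M -> F) (d : \bar F) (beta : F -> F -> F) (gamma : F -> F),
    [/\ size_function G Ks V, (0 < d)%E, classKL beta, classKd d gamma
      & forall W : nat -> M, in_linf W -> ((linf_norm W)%:E < d)%E ->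
        forall K : nat -> M, G (K 0%N) ->
          (forall k, K k.+1 = f k (K k) (W k)) ->
          forall k, G (K k) /\
            V (K k) <= beta (V (K 0%N)) k%:R + gamma (linf_norm W)].

End SmallDisturbanceISS.

(* Main.v *)
Require Import Defs.
From mathcomp Require Import spectral ring lra.
Local Open Scope classical_set_scope.
Local Open Scope ring_scope.

Set Implicit Arguments.
Unset Strict Implicit.
Unset Printing Implicit Defensive.

(** The size function is the cost gap [J K - J Ks] over the optimal gain [Ks].

    Everything rests on one exact expansion of the cost between two stabilizing
    gains [K] and [K + E]. The two Lyapunov equations, for [P] and for the
    correlation matrix [Y], are dual for the trace inner product, and this turns
    [J (K + E) - J K] into the linear term [<grad J K, E>] plus two traces that
    are quadratic in [E] and contain [Y] at the new gain ([lqr_J_taylor]).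
    Elementary norm bounds make the remainder at most
    [c h * J (K + E) * |E|^2] with [h = J K] and [L h = 2 * h * c h]
    ([J_remainder], [lqr_LE]): the step size threshold of the theorem is this
    constant. No derivative of [J] is ever taken.

    The expansion gives the continuity of [J]. As [P K] stays a quadratic
    Lyapunov function in an explicit ball around [K] ([stable_ball]) and bounds
    [K] itself ([gain_op]), sublevel sets are compact and [J] is coercive. It
    also gives descent: a step of size at most [1 / L] along the gradient plus a
    disturbance of at most half its norm stays stabilizing and lowers the cost
    by a fixed fraction of [eta * |grad|^2] ([perturbed_descent]). Applied
    without disturbance at a minimizer of [J], it shows that the gradient
    vanishes there, so that the Riccati equation is solvable and [Ks] is the
    minimizer ([riccati_exists], [opt_gain_props]).

    The gradient is bounded below by the minimum of a multiple of the square
    root of the cost gap and a positive constant ([gradient_domination]); the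
    saturation is the reason why only small disturbances are tolerated. When the
    disturbance [w] is small and the gradient exceeds [2 * w], the cost gap
    contracts. Otherwise gradient domination puts the gap below a multiple of
    [w ^+ 2], and the expansion shows that one step keeps it there
    ([perturbed_step]). Along a trajectory the gap is thus at most a multiple of
    [w ^+ 2], or its initial value divided by one plus a multiple of the sum of
    the step sizes so far. That multiple and the lower bounds on the step sizes
    depend on a bound for the initial value; gluing the countably many resulting
    rates gives the KL function ([glued]).

    For the Lyapunov equation itself no matrix exponential is used. A Hurwitz
    matrix has a quadratic Lyapunov function by unitary triangularization
    ([hurwitz_certificate]), and comparing a symmetric solution with it at an
    extremal generalized eigenvector gives positivity, monotonicity and, for a
    doubled system, uniqueness ([lyap_nn], [lyap_inj]). *)

(** * The Frobenius inner product *)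

Section InnerProduct.
Variable F : realType.

Definition ip (m n : nat) (X Y : 'M[F]_(m, n)) : F := \tr (X^T *m Y).

Lemma ipE m n (X Y : 'M[F]_(m, n)) : ip X Y = \sum_i \sum_j X i j * Y i j.
Proof.
rewrite /ip /mxtrace exchange_big /=; apply: eq_bigr => j _.
by rewrite mxE; apply: eq_bigr => i _; rewrite mxE.
Qed.

Lemma ipC m n (X Y : 'M[F]_(m, n)) : ip X Y = ip Y X.
Proof. by rewrite /ip -mxtrace_tr trmx_mul trmxK. Qed.

Lemma ipDl m n (X Y Z : 'M[F]_(m, n)) : ip (X + Y) Z = ip X Z + ip Y Z.
Proof. by rewrite /ip !linearD /= mulmxDl linearD. Qed.
Lemma ipDr m n (X Y Z : 'M[F]_(m, n)) : ip Z (X + Y) = ip Z X + ip Z Y.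
Proof. by rewrite ipC ipDl !(ipC Z). Qed.
Lemma ipZl m n a (X Y : 'M[F]_(m, n)) : ip (a *: X) Y = a * ip X Y.
Proof. by rewrite /ip !linearZ /= -scalemxAl linearZ. Qed.
Lemma ipZr m n a (X Y : 'M[F]_(m, n)) : ip X (a *: Y) = a * ip X Y.
Proof. by rewrite ipC ipZl ipC. Qed.
Lemma ipNl m n (X Y : 'M[F]_(m, n)) : ip (- X) Y = - ip X Y.
Proof. by rewrite -scaleN1r ipZl mulN1r. Qed.
Lemma ipNr m n (X Y : 'M[F]_(m, n)) : ip X (- Y) = - ip X Y.
Proof. by rewrite ipC ipNl ipC. Qed.
Lemma ip0l m n (X : 'M[F]_(m, n)) : ip 0 X = 0.
Proof. by rewrite -(scale0r 0) ipZl mul0r. Qed.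
Lemma ip0r m n (X : 'M[F]_(m, n)) : ip X 0 = 0.
Proof. by rewrite ipC ip0l. Qed.
Definition ip_lin := (ipDl, ipDr, ipNl, ipNr, ipZl, ipZr).

Lemma ipMl m n p (A : 'M[F]_(m, n)) (X : 'M[F]_(n, p)) (Y : 'M[F]_(m, p)) :
  ip (A *m X) Y = ip X (A^T *m Y).
Proof. by rewrite /ip trmx_mul mulmxA. Qed.

Lemma ipMr m n p (A : 'M[F]_(n, p)) (X : 'M[F]_(m, n)) (Y : 'M[F]_(m, p)) :
  ip (X *m A) Y = ip X (Y *m A^T).
Proof. by rewrite /ip trmx_mul -mulmxA mxtrace_mulC mulmxA. Qed.

Lemma ip_tr m n (X Y : 'M[F]_(m, n)) : ip X^T Y^T = ip X Y.
Proof. by rewrite ipC /ip trmxK mxtrace_mulC. Qed.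

Lemma ip_cV n (x y : 'cV[F]_n) : ip x y = (x^T *m y) 0 0.
Proof. by rewrite /ip trace_mx11. Qed.

Lemma ip_ge0 m n (X : 'M[F]_(m, n)) : 0 <= ip X X.
Proof.
by rewrite ipE; apply: sumr_ge0 => i _; apply: sumr_ge0 => j _; rewrite -expr2 sqr_ge0.
Qed.

Lemma ip_eq0 m n (X : 'M[F]_(m, n)) : (ip X X == 0) = (X == 0).
Proof.
apply/eqP/eqP => [|->]; last by rewrite ip0l.
rewrite ipE => /eqP; rewrite psumr_eq0 => [/allP X0|i _]; last first.
  by apply: sumr_ge0 => j _; rewrite -expr2 sqr_ge0.
apply/matrixP => i j; rewrite mxE.
have := X0 i (mem_index_enum _); rewrite psumr_eq0 => [/allP /(_ j)|k _].
  by rewrite -expr2 sqrf_eq0 mem_index_enum => /(_ isT) /eqP.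
by rewrite -expr2 sqr_ge0.
Qed.

Lemma ip_gt0 m n (X : 'M[F]_(m, n)) : X != 0 -> 0 < ip X X.
Proof. by move=> X0; rewrite lt_def ip_ge0 andbT ip_eq0. Qed.

Lemma froE m n (X : 'M[F]_(m, n)) : frobenius X = Num.sqrt (ip X X).
Proof. by rewrite ipE. Qed.

Lemma fro_ge0 m n (X : 'M[F]_(m, n)) : 0 <= frobenius X.
Proof. exact: sqrtr_ge0. Qed.

Lemma fro_sq m n (X : 'M[F]_(m, n)) : frobenius X ^+ 2 = ip X X.
Proof. by rewrite froE sqr_sqrtr // ip_ge0. Qed.

Lemma fro_eq0 m n (X : 'M[F]_(m, n)) : (frobenius X == 0) = (X == 0).
Proof. by rewrite -ip_eq0 -fro_sq sqrf_eq0. Qed.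

Lemma fro0 m n : frobenius (0 : 'M[F]_(m, n)) = 0.
Proof. by apply/eqP; rewrite fro_eq0. Qed.

Lemma fro_gt0 m n (X : 'M[F]_(m, n)) : X != 0 -> 0 < frobenius X.
Proof. by move=> X0; rewrite lt_def fro_ge0 fro_eq0 X0. Qed.

Lemma froZ m n a (X : 'M[F]_(m, n)) : frobenius (a *: X) = `|a| * frobenius X.
Proof.
by rewrite !froE ipZl ipZr mulrA -expr2 sqrtrM ?sqr_ge0 // sqrtr_sqr.
Qed.

Lemma froN m n (X : 'M[F]_(m, n)) : frobenius (- X) = frobenius X.
Proof. by rewrite !froE ipNl ipNr opprK. Qed.

Lemma fro_tr m n (X : 'M[F]_(m, n)) : frobenius X^T = frobenius X.
Proof. by rewrite !froE ip_tr. Qed.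

Lemma ler_fro m n p q (X : 'M[F]_(m, n)) (Y : 'M[F]_(p, q)) c : 0 <= c ->
  ip X X <= c ^+ 2 * ip Y Y -> frobenius X <= c * frobenius Y.
Proof.
move=> c0 XY; rewrite -ler_sqr ?nnegrE ?mulr_ge0 ?fro_ge0 //.
by rewrite exprMn !fro_sq.
Qed.

Lemma ip_CS_sq m n (X Y : 'M[F]_(m, n)) : ip X Y ^+ 2 <= ip X X * ip Y Y.
Proof.
have [->|Y0] := eqVneq Y 0; first by rewrite !ip0r expr0n mulr0.
have yy := ip_gt0 Y0.
have := ip_ge0 (X - (ip X Y / ip Y Y) *: Y).
rewrite !ip_lin (ipC Y X) => H.
rewrite -subr_ge0 -(pmulr_rge0 _ (_ : 0 < (ip Y Y)^-1)) ?invr_gt0 //.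
by apply: le_trans H _; rewrite le_eqVlt; apply/orP; left; apply/eqP; field; rewrite gt_eqF.
Qed.

Lemma ip_CS m n (X Y : 'M[F]_(m, n)) : ip X Y <= frobenius X * frobenius Y.
Proof.
apply: le_trans (ler_norm _) _.
rewrite -ler_sqr ?nnegrE ?mulr_ge0 ?fro_ge0 //.
by rewrite real_normK ?num_real // exprMn !fro_sq ip_CS_sq.
Qed.

Lemma ip_CSN m n (X Y : 'M[F]_(m, n)) : - (frobenius X * frobenius Y) <= ip X Y.
Proof. by rewrite lerNl -ipNl -(froN X) ip_CS. Qed.

Lemma froD m n (X Y : 'M[F]_(m, n)) : frobenius (X + Y) <= frobenius X + frobenius Y.
Proof.
rewrite -ler_sqr ?nnegrE ?addr_ge0 ?fro_ge0 // fro_sq !ip_lin (ipC Y X).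
rewrite sqrrD !fro_sq; have := ip_CS X Y; lra.
Qed.

Lemma froB m n (X Y : 'M[F]_(m, n)) : frobenius (X - Y) <= frobenius X + frobenius Y.
Proof. by rewrite -(froN Y) froD. Qed.

Lemma ip_col m n (X Y : 'M[F]_(m, n)) : ip X Y = \sum_j ip (col j X) (col j Y).
Proof.
rewrite ipE exchange_big /=; apply: eq_bigr => j _; rewrite ipE; apply: eq_bigr => i _.
by rewrite big_ord1 !mxE.
Qed.

(** The squared Frobenius norm of a product is the sum over its columns. *)
Lemma fro_mul_op m n p (A : 'M[F]_(m, n)) (X : 'M[F]_(n, p)) c : 0 <= c ->
  (forall x : 'cV_n, frobenius (A *m x) <= c * frobenius x) ->
  frobenius (A *m X) <= c * frobenius X.
Proof.
move=> c0 Ac; apply: ler_fro => //.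
rewrite (ip_col (A *m X)) (ip_col X) mulr_sumr; apply: ler_sum => j _.
rewrite -!fro_sq -exprMn ler_sqr ?nnegrE ?mulr_ge0 ?fro_ge0 //.
by rewrite colE -mulmxA -colE Ac.
Qed.

Lemma fro_op m n (A : 'M[F]_(m, n)) (x : 'cV_n) :
  frobenius (A *m x) <= frobenius A * frobenius x.
Proof.
apply: ler_fro; first exact: fro_ge0.
rewrite fro_sq -(ip_tr A) (ip_col A^T) mulr_suml ipE; apply: ler_sum => i _.
rewrite big_ord1 -expr2.
have -> : (A *m x) i 0 = ip (col i A^T) x.
  by rewrite ip_cV !mxE; apply: eq_bigr => j _; rewrite !mxE.
exact: ip_CS_sq.
Qed.

Lemma fro_mul m n p (A : 'M[F]_(m, n)) (X : 'M[F]_(n, p)) :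
  frobenius (A *m X) <= frobenius A * frobenius X.
Proof. by apply: fro_mul_op (fro_ge0 _) (fro_op A). Qed.

(** Test [A^T *m y] against itself and move the transpose across. *)
Lemma op_tr m n (A : 'M[F]_(m, n)) c : 0 <= c ->
  (forall x : 'cV_n, frobenius (A *m x) <= c * frobenius x) ->
  forall y : 'cV_m, frobenius (A^T *m y) <= c * frobenius y.
Proof.
move=> c0 Ac y; have [->|z0] := eqVneq (A^T *m y) 0.
  by rewrite fro0 mulr_ge0 ?fro_ge0.
rewrite -(ler_pM2l (fro_gt0 z0)) -expr2 fro_sq ipMl trmxK.
apply: le_trans (ip_CS _ _) _; rewrite mulrC mulrA.
by rewrite (mulrC _ c) ler_wpM2r ?fro_ge0.
Qed.

(** Polarization of [<y, S *m x>] with [y] the multiple of [S *m x] that has the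
    norm of [x]. *)
Lemma sym_form_op n (S : 'M[F]_n) c : S^T = S -> 0 <= c ->
  (forall x : 'cV_n, ip x (S *m x) <= c * ip x x) ->
  (forall x : 'cV_n, - (c * ip x x) <= ip x (S *m x)) ->
  forall x : 'cV_n, frobenius (S *m x) <= c * frobenius x.
Proof.
move=> Ssym c0 Su Sl x.
have [->|Sx0] := eqVneq (S *m x) 0; first by rewrite fro0 mulr_ge0 ?fro_ge0.
have x0 : x != 0 by apply: contra_neq Sx0 => ->; rewrite mulmx0.
have fx := fro_gt0 x0; have fS := fro_gt0 Sx0.
pose y := (frobenius x / frobenius (S *m x)) *: (S *m x).
have yy : ip y y = ip x x.
  by rewrite /y ipZl ipZr -!fro_sq; field; rewrite gt_eqF.
have Sxy : ip y (S *m x) = frobenius x * frobenius (S *m x).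
  by rewrite /y ipZl -fro_sq; field; rewrite gt_eqF.
clearbody y.
have Syx : ip x (S *m y) = ip y (S *m x) by rewrite -{1}Ssym -ipMl ipC.
have := Su (x + y); have := Sl (x - y).
rewrite !mulmxDr !mulmxN !ip_lin Syx Sxy (ipC y x) yy -!fro_sq => H1 H2.
rewrite -fro_sq in yy.
rewrite -(ler_pM2l fx); lra.
Qed.

End InnerProduct.

(** * The matrix topology through the Frobenius norm *)

Section Topology.
Variable F : realType.

Lemma mxnorm_le_fro m n (X : 'M[F]_(m, n)) : `|X| <= frobenius X.
Proof.
rewrite [leLHS]/Num.norm /= mx_normrE; apply/bigmax_leP; split => [|[i j] _ /=].
  exact: fro_ge0.
rewrite -ler_sqr ?nnegrE ?fro_ge0 // fro_sq real_normK ?num_real // ipE.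
rewrite (bigD1 i) //= (bigD1 j) //= -expr2 -addrA lerDl addr_ge0 //.
  by apply: sumr_ge0 => k _; rewrite -expr2 sqr_ge0.
by apply: sumr_ge0 => k _; apply: sumr_ge0 => l _; rewrite -expr2 sqr_ge0.
Qed.

Lemma entry_le_mxnorm m n (X : 'M[F]_(m, n)) i j : `|X i j| <= `|X|.
Proof.
rewrite [leRHS]/Num.norm /= mx_normrE; apply/bigmax_geP; right => /=.
by exists (i, j).
Qed.

Lemma fro_le_mxnorm m n (X : 'M[F]_(m, n)) :
  frobenius X <= (m * n).+1%:R * `|X|.
Proof.
rewrite -ler_sqr ?nnegrE ?fro_ge0 ?mulr_ge0 // fro_sq ipE.
apply: (@le_trans _ _ (\sum_(i < m) \sum_(j < n) `|X| ^+ 2)).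
  apply: ler_sum => i _; apply: ler_sum => j _.
  by rewrite -expr2 -[leLHS]real_normK ?num_real // lerXn2r ?nnegrE // entry_le_mxnorm.
rewrite !sumr_const !card_ord -mulrnA exprMn -[leLHS]mulr_natl ler_wpM2r ?sqr_ge0 //.
rewrite mulnC -natrX ler_nat expnS expn1.
by rewrite (leq_trans (leqnSn _)) // leq_pmulr.
Qed.

(** Every topological notion on matrices is turned into an estimate through this
    neighbourhood base. *)
Lemma nbhs_froP m n (X : 'M[F]_(m, n)) (P : set 'M[F]_(m, n)) :
  nbhs X P <-> exists2 e, 0 < e & forall Y, frobenius (Y - X) < e -> P Y.
Proof.
split => [/nbhs_ballP [e /= e0 eP]|[e e0 eP]].
  exists e => // Y XY; apply: eP; rewrite -ball_normE /=.
  by rewrite -normrN opprB (le_lt_trans (mxnorm_le_fro _)).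
apply/nbhs_ballP; exists (e / (m * n).+1%:R); first by rewrite /= divr_gt0.
move=> Y; rewrite -ball_normE /=; rewrite ltr_pdivlMr ?ltr0n // mulrC -normrN opprB => XY.
exact: eP (le_lt_trans (fro_le_mxnorm _) XY).
Qed.

Lemma within_continuous_fro m n (S : set 'M[F]_(m, n)) (f : 'M[F]_(m, n) -> F) :
  (forall X, S X -> forall e, 0 < e -> exists2 d, 0 < d &
     forall Y, S Y -> frobenius (Y - X) < d -> `|f Y - f X| <= e) ->
  {within S, continuous f}.
Proof.
move=> fS; apply/subspace_continuousP => X SX; apply/cvgrPdist_le => e e0.
have [d d0 dP] := fS X SX e e0.
rewrite /prop_near1 /within /=; apply/nbhs_froP; exists d => // Y YX SY.
by rewrite distrC dP.
Qed.

Lemma continuous_sumr (T : topologicalType) (I : Type) (r : seq I)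
    (f : I -> T -> F) :
  (forall i, continuous (f i)) -> continuous (fun y => \sum_(i <- r) f i y).
Proof.
move=> fc; elim: r => [|i r IH].
  have -> : (fun y => \sum_(i <- [::]) f i y) = (fun=> 0).
    by apply/funext => y; rewrite big_nil.
  by move=> x; exact: cst_continuous.
have -> : (fun y => \sum_(i <- i :: r) f i y) = f i \+ (fun y => \sum_(i <- r) f i y).
  by apply/funext => y; rewrite big_cons.
by move=> x; apply: continuousD; [exact: fc|exact: IH].
Qed.

Lemma continuous_form n (X : 'M[F]_n) :
  continuous (fun x : 'cV[F]_n => ip x (X *m x)).
Proof.
have -> : (fun x : 'cV[F]_n => ip x (X *m x)) =
    (fun x => \sum_i \sum_j x i j * (\sum_k X i k * x k j)).
  apply/funext => x; rewrite ipE; apply: eq_bigr => i _; apply: eq_bigr => j _.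
  by rewrite mxE.
apply: continuous_sumr => i; apply: continuous_sumr => j x.
apply: continuousM; first exact: coord_continuous.
apply: continuous_sumr => k {}x; apply: continuousM; first exact: cst_continuous.
exact: coord_continuous.
Qed.

Lemma fro_vec m n (u : 'rV[F]_(m * n)) : frobenius (vec_mx u) = frobenius u.
Proof.
rewrite !froE !ipE; congr Num.sqrt; rewrite big_ord1 pair_big /=.
rewrite (reindex _ (curry_mxvec_bij m n)) /=.
by apply: eq_bigr => -[i j] _; rewrite !mxE.
Qed.

Lemma fro_bounded_closed_compact m n (S : set 'M[F]_(m, n)) c :
  (forall X, S X -> frobenius X <= c) -> closed S -> compact S.
Proof.
move=> Sc Scl.
have vc : continuous (@vec_mx F m n).
  move=> u P /nbhs_froP [e e0 eP]; apply/nbhs_froP; exists e => // v vu.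
  by apply: eP; rewrite -linearB /= fro_vec.
have -> : S = (@vec_mx F m n) @` ((@vec_mx F m n) @^-1` S).
  apply/seteqP; split => [X SX|_ [u Su <-]//].
  by exists (mxvec X); rewrite /= mxvecK.
apply: continuous_compact; first exact: continuous_subspaceT.
apply: bounded_closed_compact; last first.
  by apply: preimage_closed => // u _; exact: vc.
exists c; split; first exact: num_real.
move=> d cd u Su; apply: le_trans (mxnorm_le_fro _) _; rewrite -fro_vec.
exact: le_trans (Sc _ Su) (ltW cd).
Qed.

End Topology.

(** * Quadratic forms and extremal eigenvalues *)

Section Forms.
Variable F : realType.

Definition posform n (X : 'M[F]_n) := forall x : 'cV[F]_n, x != 0 -> 0 < ip x (X *m x).
Definition nnform n (X : 'M[F]_n) := forall x : 'cV[F]_n, 0 <= ip x (X *m x).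

Lemma sym_posdefE n (X : 'M[F]_n) : sym_posdef X <-> X^T = X /\ posform X.
Proof.
by split=> -[sX X0]; split => // x x0; [rewrite ip_cV mulmxA|rewrite -mulmxA -ip_cV]; apply: X0.
Qed.

Lemma posform_nn n (X : 'M[F]_n) : posform X -> nnform X.
Proof.
by move=> X0 x; have [->|x0] := eqVneq x 0; [rewrite mulmx0 ip0r|exact/ltW/X0].
Qed.

Lemma posform1 n : posform (1%:M : 'M[F]_n).
Proof. by move=> x x0; rewrite mul1mx ip_gt0. Qed.

(** Move from [x] a little in the direction of [- X *m x]: the form would
    decrease below zero to first order if [X *m x] were nonzero. *)
Lemma nnform_null n (X : 'M[F]_n) (x : 'cV[F]_n) : X^T = X -> nnform X ->
  ip x (X *m x) = 0 -> X *m x = 0.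
Proof.
move=> sX X0 x0; apply/eqP; rewrite -ip_eq0; apply/eqP.
set a := ip _ _; set c := ip (X *m x) (X *m (X *m x)).
have a0 : 0 <= a by exact: ip_ge0.
have c0 : 0 <= c by exact: X0.
(* The step [a / (c + 1)] is below the minimizer [a / c] and avoids [c = 0]. *)
have := X0 (x - (a / (c + 1)) *: (X *m x)).
rewrite mulmxDr mulmxN -scalemxAr !ip_lin x0 -/a -/c.
have -> : ip x (X *m (X *m x)) = a by rewrite -{1}sX -ipMl.
have c1 : 0 < c + 1 by lra.
move=> H; apply/eqP; rewrite eq_le a0 andbT leNgt; apply/negP => ap.
have : 0 < a ^+ 2 / (c + 1) ^+ 2 * (c + 2).
  by rewrite mulr_gt0 ?divr_gt0 ?exprn_gt0 //; lra.
suff -> : a ^+ 2 / (c + 1) ^+ 2 * (c + 2) =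
  - (0 - a / (c + 1) * a + - (a / (c + 1) * a - a / (c + 1) * (a / (c + 1) * c))).
  lra.
by field; rewrite gt_eqF.
Qed.

(** The smallest generalized eigenvalue of a pencil: minimize the quotient of
    the forms over the unit sphere; at a minimizer the form of [X - mu *: H] is
    nonnegative with a null vector. *)
Lemma rayleigh n (X H : 'M[F]_n) : (0 < n)%N -> X^T = X -> H^T = H -> posform H ->
  exists mu : F, exists x : 'cV[F]_n,
    [/\ x != 0, X *m x = mu *: (H *m x)
      & forall y : 'cV[F]_n, mu * ip y (H *m y) <= ip y (X *m y)].
Proof.
move=> n0 sX sH H0.
pose S := [set x : 'cV[F]_n | ip x (1%:M *m x) = 1].
have SE x : S x -> x != 0.
  by rewrite /S /=; apply: contra_eq_neq => ->; rewrite ip0l eq_sym oner_neq0.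
have Sne : S !=set0.
  exists (delta_mx (Ordinal n0) 0); rewrite /S /= mul1mx ipE (bigD1 (Ordinal n0)) //=.
  rewrite big_ord1 mxE !eqxx mulr1 big1 ?addr0 // => i /negPf i0.
  by rewrite big_ord1 mxE i0 mul0r.
have Scpt : compact S.
  apply: (@fro_bounded_closed_compact _ _ _ _ 1) => [x|].
    by rewrite /S /= mul1mx froE => ->; rewrite sqrtr1.
  apply: (@preimage_closed _ _ (fun x : 'cV[F]_n => ip x (1%:M *m x)) [set 1]).
    by move=> x _; exact: continuous_form.
  exact: closed_eq.
pose f (x : 'cV[F]_n) := ip x (X *m x) / ip x (H *m x).
have fc : {within S, continuous f}.
  apply: continuous_in_subspaceT => x /set_mem /SE x0.
  apply: (@continuousM _ _ (fun y : 'cV[F]_n => ip y (X *m y))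
            (fun y => (ip y (H *m y))^-1)); first exact: continuous_form.
  apply: (@continuousV _ _ (fun y : 'cV[F]_n => ip y (H *m y))).
    by rewrite gt_eqF ?H0.
  exact: continuous_form.
have [c [Sc cmin]] : exists c : 'cV[F]_n, S c /\ forall t : 'cV[F]_n, S t -> f c <= f t.
  have [c /set_mem Sc cmin] := compact_EVT_min Sne Scpt fc.
  by exists c; split => // t St; apply/cmin/mem_set.
have c0 := SE c Sc; have Hc := H0 c c0.
have cX : f c * ip c (H *m c) = ip c (X *m c) by rewrite /f divfK // gt_eqF.
have fle (y : 'cV[F]_n) : f c * ip y (H *m y) <= ip y (X *m y).
  have [->|y0] := eqVneq y 0; first by rewrite !ip0l mulr0.
  have Hy := H0 y y0; have fy := fro_gt0 y0.
  pose z := (frobenius y)^-1 *: y.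
  have Sz : S z.
    by rewrite /S /= mul1mx /z ipZl ipZr -fro_sq; field; rewrite gt_eqF.
  have := cmin z Sz.
  suff -> : f z = f y by rewrite /f -[X in _ -> _ <= X](@divfK _ (ip y (H *m y))) ?gt_eqF // ler_pM2r.
  rewrite /f /z -!scalemxAr !ip_lin; field; rewrite !gt_eqF //.
exists (f c), c; split => //.
apply/eqP; rewrite -subr_eq0 scalemxAl -mulmxBl; apply/eqP.
apply: nnform_null => [|y|].
- by rewrite linearB /= linearZ /= sX sH.
- by rewrite mulmxBl -scalemxAl !ip_lin subr_ge0.
- by rewrite mulmxBl -scalemxAl !ip_lin cX subrr.
Qed.

(** Compare with the identity; the minimal eigenvalue is positive. *)
Lemma posform_lower n (H : 'M[F]_n) : H^T = H -> posform H ->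
  exists2 c, 0 < c & forall x : 'cV[F]_n, c * ip x x <= ip x (H *m x).
Proof.
case: n H => [|n] H sH H0.
  by exists 1 => // x; rewrite (flatmx0 x) !ip0l mulr0.
have [mu [x [x0 Hx muH]]] := rayleigh (ltn0Sn n) sH (@trmx1 _ _) (@posform1 n.+1).
exists mu => [|y]; last by have := muH y; rewrite mul1mx.
have := H0 x x0; rewrite Hx mul1mx ipZr pmulr_lgt0 // ip_gt0 //.
Qed.

Lemma sym_eigenvalueP n (H : 'M[F]_n) l : H^T = H ->
  eigenvalue H l <-> exists2 x : 'cV[F]_n, H *m x = l *: x & x != 0.
Proof.
move=> sH; split=> [/eigenvalueP [v vH v0]|[x Hx x0]].
  exists v^T; rewrite ?trmx_eq0 //.
  by rewrite -[in LHS]sH -trmx_mul vH linearZ.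
apply/eigenvalueP; exists x^T; rewrite ?trmx_eq0 //.
by rewrite -[in LHS]sH -trmx_mul Hx linearZ.
Qed.

Lemma lambda_minP n (H : 'M[F]_n) : (0 < n)%N -> sym_posdef H ->
  0 < lambda_min H /\
  forall x : 'cV[F]_n, lambda_min H * ip x x <= ip x (H *m x).
Proof.
move=> n0 /sym_posdefE [sH H0].
have [mu [x [x0 Hx muH]]] := rayleigh n0 sH (@trmx1 _ _) (@posform1 n).
rewrite mul1mx in Hx.
have mu_eig : eigenvalue H mu by apply/(sym_eigenvalueP _ sH); exists x.
have mu_lb : lbound [set l : F | eigenvalue H l] mu.
  move=> l /= /(sym_eigenvalueP _ sH) [v Hv v0].
  by rewrite -(ler_pM2r (ip_gt0 v0)); have := muH v; rewrite mul1mx Hv ipZr.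
have -> : lambda_min H = mu.
  apply/eqP; rewrite eq_le; apply/andP; split.
    by apply: ge_inf => //; exists mu.
  by apply: lb_le_inf => //; exists mu.
split=> [|y]; last by have := muH y; rewrite mul1mx.
by have := H0 x x0; rewrite Hx ipZr pmulr_lgt0 // ip_gt0.
Qed.

Lemma spectral_norm_ub m n (A : 'M[F]_(m, n)) :
  has_ubound [set frobenius (A *m x) | x in [set x : 'cV[F]_n | frobenius x <= 1]].
Proof.
exists (frobenius A) => _ [x /= x1 <-]; apply: le_trans (fro_op _ _) _.
by rewrite ler_piMr ?fro_ge0.
Qed.

Lemma spectral_norm_ge0 m n (A : 'M[F]_(m, n)) : 0 <= spectral_norm A.
Proof.
apply: (ub_le_sup (spectral_norm_ub A)); exists 0; rewrite /= ?fro0 ?ler01 //.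
by rewrite mulmx0 fro0.
Qed.

Lemma spectral_norm_op m n (A : 'M[F]_(m, n)) (x : 'cV[F]_n) :
  frobenius (A *m x) <= spectral_norm A * frobenius x.
Proof.
have [->|x0] := eqVneq x 0; first by rewrite mulmx0 !fro0 mulr0.
have fx := fro_gt0 x0.
rewrite -ler_pdivrMr //; apply: (ub_le_sup (spectral_norm_ub A)).
exists ((frobenius x)^-1 *: x) => /=.
  by rewrite froZ ger0_norm ?invr_ge0 ?fro_ge0 // mulVf ?gt_eqF.
by rewrite -scalemxAr froZ ger0_norm ?invr_ge0 ?fro_ge0 // mulrC.
Qed.

Lemma spectral_norm_le m n (A : 'M[F]_(m, n)) c :
  (forall x : 'cV[F]_n, frobenius x <= 1 -> frobenius (A *m x) <= c) ->
  spectral_norm A <= c.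
Proof.
move=> Ac; apply: ge_sup => [|_ [x /= x1 <-]]; last exact: Ac.
exists (frobenius (A *m (0 : 'cV_n))); exists 0 => //=.
by rewrite fro0 ler01.
Qed.

End Forms.

(** * Quadratic Lyapunov functions of Hurwitz matrices *)

Section HurwitzCertificate.
Variable F : realType.

Local Notation C := (complex F).
Local Notation re := (map_mx (@complex.Re F)).
Local Notation im := (map_mx (@complex.Im F)).
Local Notation cpx := (map_mx (real_complex F)).

Lemma ReD (x y : F[i]) : complex.Re (x + y) = complex.Re x + complex.Re y.
Proof. by case: x y => [? ?] [? ?]. Qed.
Lemma ImD (x y : F[i]) : complex.Im (x + y) = complex.Im x + complex.Im y.
Proof. by case: x y => [? ?] [? ?]. Qed.
Lemma ReM (x y : F[i]) :
  complex.Re (x * y) = complex.Re x * complex.Re y - complex.Im x * complex.Im y.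
Proof. by case: x y => [? ?] [? ?]. Qed.
Lemma ImM (x y : F[i]) :
  complex.Im (x * y) = complex.Re x * complex.Im y + complex.Im x * complex.Re y.
Proof. by case: x y => [? ?] [? ?]. Qed.

Lemma re_mulmx m n p (X : 'M[C]_(m, n)) (Y : 'M[C]_(n, p)) :
  re (X *m Y) = re X *m re Y - im X *m im Y.
Proof.
apply/matrixP => i j; rewrite !mxE (big_morph _ ReD (erefl : complex.Re 0 = 0)) -sumrB.
by apply: eq_bigr => k _; rewrite !mxE ReM.
Qed.

Lemma im_mulmx m n p (X : 'M[C]_(m, n)) (Y : 'M[C]_(n, p)) :
  im (X *m Y) = re X *m im Y + im X *m re Y.
Proof.
apply/matrixP => i j; rewrite !mxE (big_morph _ ImD (erefl : complex.Im 0 = 0)) -big_split.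
by apply: eq_bigr => k _; rewrite !mxE ImM.
Qed.

Lemma re_cpx m n (X : 'M[F]_(m, n)) : re (cpx X) = X.
Proof. by apply/matrixP => i j; rewrite !mxE. Qed.
Lemma im_cpx m n (X : 'M[F]_(m, n)) : im (cpx X) = 0.
Proof. by apply/matrixP => i j; rewrite !mxE. Qed.

Lemma re_im_eq0 m n (X : 'M[C]_(m, n)) : re X = 0 -> im X = 0 -> X = 0.
Proof.
move=> /matrixP r0 /matrixP i0; apply/matrixP => i j.
have := r0 i j; have := i0 i j; rewrite !mxE.
by case: (X i j) => a b /= -> ->.
Qed.

Lemma eigenvalueE (K : fieldType) n (M : 'M[K]_n) z :
  eigenvalue M z = (M - z%:M \notin unitmx).
Proof. by rewrite /eigenvalue /eigenspace kermx_eq0 row_free_unit. Qed.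

Lemma eigenvalue_tr (K : fieldType) n (M : 'M[K]_n) z :
  eigenvalue M^T z = eigenvalue M z.
Proof.
have E : M^T - z%:M = (M - z%:M)^T by rewrite linearB /= tr_scalar_mx.
by rewrite !eigenvalueE E unitmx_tr.
Qed.

Lemma hurwitz_tr n (M : 'M[F]_n) : hurwitz M -> hurwitz M^T.
Proof.
move=> hM z; rewrite -map_trmx eigenvalue_tr.
exact: (hM z).
Qed.

(** [H] is a quadratic Lyapunov function for the flow of [M]: the derivative of
    its form along the flow is twice the form of [H *m M]. *)
Definition certificate n (M H : 'M[F]_n) :=
  [/\ H^T = H, posform H &
      forall x : 'cV[F]_n, x != 0 -> ip x (H *m M *m x) < 0].

(** For the real and imaginary parts of a complex eigenvector, the forms of
    [H *m M] add up to the real part of the eigenvalue times a nonnegative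
    quantity. *)
Lemma certificate_hurwitz n (M H : 'M[F]_n) : certificate M H -> hurwitz M.
Proof.
move=> [sH H0 HM] z; rewrite -eigenvalue_tr => /eigenvalueP [v vM v0].
pose w := v^T; have w0 : w != 0 by rewrite trmx_eq0.
have Mw : cpx M *m w = z *: w by rewrite /w -[cpx M]trmxK -trmx_mul vM linearZ.
pose a := re w; pose b := im w.
have Ma : M *m a = complex.Re z *: a - complex.Im z *: b.
  have := congr1 re Mw; rewrite re_mulmx re_cpx im_cpx mul0mx subr0 => ->.
  by apply/matrixP => i j; rewrite !mxE ReM.
have Mb : M *m b = complex.Re z *: b + complex.Im z *: a.
  have := congr1 im Mw; rewrite im_mulmx re_cpx im_cpx mul0mx addr0 => ->.
  by apply/matrixP => i j; rewrite !mxE ImM.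
have Hnn := posform_nn H0.
have HMn (y : 'cV[F]_n) : ip y (H *m M *m y) <= 0.
  by have [->|y0] := eqVneq y 0; [rewrite mulmx0 ip0r|exact: ltW (HM y y0)].
have ab : ip a (H *m M *m a) + ip b (H *m M *m b) < 0.
  have [a0|a0] := eqVneq a 0.
    have b0 : b != 0 by apply: contra_neq w0 => b0; exact: re_im_eq0.
    by have := HM b b0; have := HMn a; lra.
  by have := HM a a0; have := HMn b; lra.
have abH : 0 <= ip a (H *m a) + ip b (H *m b) by rewrite addr_ge0 ?Hnn.
have Hab : ip a (H *m b) = ip b (H *m a) by rewrite ipC ipMl sH.
move: ab; rewrite -!mulmxA Ma Mb !(mulmxDr, mulmxN) -!scalemxAr !ip_lin Hab.
by rewrite ltNge => ab; rewrite ltNge; apply: contra ab => z0; nra.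
Qed.

Lemma exists_lower_bound n (f : 'I_n -> F) : (forall i, 0 < f i) ->
  exists2 a, 0 < a & forall i, a <= f i.
Proof.
move=> f0; exists (\big[Num.min/1]_i f i); last by move=> i; exact: bigmin_le_cond.
by elim/big_ind: _ => // x y x0 y0; rewrite lt_min x0.
Qed.

Lemma exists_small_scale (a c : F) : 0 < a -> 0 <= c ->
  exists d, [/\ 0 < d, d <= 1 & d * c <= a / 2].
Proof.
move=> a0 c0; have c1 : 0 < 2 * (c + 1) by lra.
exists (Num.min 1 (a / (2 * (c + 1)))); split.
- by rewrite lt_min ltr01 divr_gt0.
- by rewrite ge_min lexx.
apply: (@le_trans _ _ (a / (2 * (c + 1)) * c)).
  by rewrite ler_wpM2r // ge_min lexx orbT.
rewrite -subr_ge0 (_ : _ - _ = a / (2 * (c + 1))); last by field; lra.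
by rewrite divr_ge0 ?ltW.
Qed.

(** Unitary triangularization reduces the matrix to a lower triangular one, and
    a diagonal scaling by powers of a small [d] makes its off-diagonal part
    negligible against the real parts of the eigenvalues, which sit on the
    diagonal; the squared norm in the scaled coordinates is then a certificate. *)
Lemma hurwitz_certificate n (M : 'M[F]_n) : hurwitz M -> exists H, certificate M H.
Proof.
case: n M => [|n] M hM.
  exists 0; split=> [|x|x]; first by rewrite linear0.
    by rewrite (flatmx0 x) eqxx.
  by rewrite (flatmx0 x) eqxx.
have [P Pu Ptrig] := @Schur F[i] n.+1 (cpx M) isT.
have Punit := unitarymx_unit Pu.
pose T := conjmx P (cpx M).
have Ttrig : forall i j : 'I_n.+1, (i < j)%N -> T i j = 0 by apply/is_trig_mxP.
have PM : P *m cpx M = T *m P.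
  by rewrite /T conjumx // mulmxKV.
have Tii i : complex.Re (T i i) < 0.
  apply: hM; apply: (@eigenvalue_conjmx _ _ _ P).
  - by rewrite stablemx_unit.
  - by rewrite row_free_unit.
  rewrite -topredE /= eigenvalue_root_char char_poly_trig //.
  by rewrite /root horner_prod (bigD1 i) //= hornerXsubC subrr mul0r.
clearbody T.
have [a a0 aT] : exists2 a, 0 < a & forall i, a <= - complex.Re (T i i).
  by apply: exists_lower_bound => i; rewrite oppr_gt0.
pose c i j : F := `|complex.Re (T i j)| + `|complex.Im (T i j)|.
pose cs : F := \sum_i \sum_j c i j.
have c0 i j : 0 <= c i j by rewrite addr_ge0.
have cs0 : 0 <= cs by apply: sumr_ge0 => i _; apply: sumr_ge0.
(* [a] bounds the real parts of the eigenvalues away from zero and [cs] is the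
   total size of the triangular matrix, so [d * cs <= a / 2] leaves half of the
   diagonal decay. *)
have [d [d0 d1 dC]] := exists_small_scale a0 cs0.
pose s i j : F := d ^+ i / d ^+ j.
pose S : 'M[C]_n.+1 := \matrix_(i, j) (real_complex F (d ^+ i) * P i j).
pose Tr : 'M[F]_n.+1 := \matrix_(i, j) (s i j * complex.Re (T i j)).
pose Ti : 'M[F]_n.+1 := \matrix_(i, j) (s i j * complex.Im (T i j)).
pose T' : 'M[C]_n.+1 := \matrix_(i, j) (real_complex F (s i j) * T i j).
(* The scaled coordinates [S] conjugate [M] to [T'], whose entry [i, j] is that of
   [T] times [d ^+ i / d ^+ j]. *)
have SM : S *m cpx M = T' *m S.
  apply/matrixP => i j; rewrite !mxE.
  have /matrixP /(_ i j) := PM; rewrite !mxE => PMij.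
  rewrite (eq_bigr (fun k => real_complex F (d ^+ i) * (P i k * cpx M k j))); last first.
    by move=> k _; rewrite !mxE mulrA.
  rewrite -mulr_sumr PMij mulr_sumr; apply: eq_bigr => k _; rewrite !mxE.
  rewrite mulrACA -rmorphM /s divfK ?expf_neq0 ?gt_eqF //.
have s1 j : s j j = 1 by rewrite /s divff // expf_neq0 // gt_eqF.
have s0 i j : 0 <= s i j by rewrite divr_ge0 ?exprn_ge0 ?ltW.
have sd (i j : 'I_n.+1) : (j < i)%N -> s i j <= d.
  by move=> ji; rewrite /s -expfB // -[leRHS]expr1 ler_wiXn2l ?subn_gt0 ?(ltW d0).
clearbody s.
have reT : re T' = Tr.
  by apply/matrixP => i j; rewrite !mxE ReM /= mul0r subr0.
have imT : im T' = Ti.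
  by apply/matrixP => i j; rewrite !mxE ImM /= mul0r addr0.
pose U := re S; pose V := im S.
have UM : U *m M = Tr *m U - Ti *m V.
  by have := congr1 re SM; rewrite !re_mulmx re_cpx im_cpx mulmx0 subr0 reT imT.
have VM : V *m M = Tr *m V + Ti *m U.
  have := congr1 im SM; rewrite !im_mulmx re_cpx im_cpx mulmx0 add0r reT imT.
  by [].
have UV0 (x : 'cV[F]_n.+1) : x != 0 -> 0 < ip (U *m x) (U *m x) + ip (V *m x) (V *m x).
  move=> x0; rewrite lt_def addr_ge0 ?ip_ge0 // andbT.
  apply: contra_neq x0 => /eqP; rewrite paddr_eq0 ?ip_ge0 // !ip_eq0.
  move=> /andP [/eqP Ux /eqP Vx].
  have Sx : S *m cpx x = 0.
    by apply: re_im_eq0; rewrite ?re_mulmx ?im_mulmx re_cpx im_cpx mulmx0 ?Ux ?Vx ?subr0 ?add0r.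
  have Px : P *m cpx x = 0.
    apply/matrixP => i j; have /matrixP /(_ i j) := Sx; rewrite !mxE.
    rewrite (eq_bigr (fun k => real_complex F (d ^+ i) * (P i k * cpx x k j))); last first.
      by move=> k _; rewrite !mxE mulrA.
    rewrite -mulr_sumr => /eqP; rewrite mulf_eq0 => /orP [|/eqP //].
    by rewrite fmorph_eq0 expf_eq0 (gt_eqF d0) andbF.
  have := congr1 (mulmx (invmx P)) Px; rewrite mulKmx // mulmx0 => x0.
  by have := congr1 re x0; rewrite re_cpx => ->; apply/matrixP => i j; rewrite !mxE.
exists (U^T *m U + V^T *m V); split=> [|x x0|x x0].
- by rewrite linearD /= !trmx_mul !trmxK.
- by rewrite mulmxDl -!mulmxA ipDr -!ipMl UV0.
have N0 := UV0 x x0; set N := (X in 0 < X) in N0.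
suff : ip x ((U^T *m U + V^T *m V) *m M *m x) <= - (a / 2) * N.
  by move/le_lt_trans; apply; rewrite mulNr oppr_lt0 mulr_gt0 // divr_gt0.
rewrite !mulmxDl -!mulmxA ipDr -!ipMl (mulmxA U) (mulmxA V) UM VM.
rewrite mulmxBl mulmxDl -!mulmxA.
set p := U *m x; set q := V *m x.
have NE : N = \sum_i (p i 0 ^+ 2 + q i 0 ^+ 2).
  rewrite /N !ipE -big_split; apply: eq_bigr => i _ /=.
  by rewrite !big_ord1 !expr2.
clearbody N p q.
have entry i j : `|p i 0 * p j 0 + q i 0 * q j 0| <= N /\ `|q i 0 * p j 0 - p i 0 * q j 0| <= N.
  have Ni k : p k 0 ^+ 2 + q k 0 ^+ 2 <= N.
    rewrite NE (bigD1 k) //= lerDl sumr_ge0 // => l _.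
    by rewrite addr_ge0 ?sqr_ge0.
  have := Ni i; have := Ni j; rewrite !ler_norml => Nj Ni'.
  have := sqr_ge0 (p i 0 + p j 0); have := sqr_ge0 (q i 0 + q j 0).
  have := sqr_ge0 (p i 0 - p j 0); have := sqr_ge0 (q i 0 - q j 0).
  have := sqr_ge0 (p i 0 + q j 0); have := sqr_ge0 (q i 0 + p j 0).
  have := sqr_ge0 (p i 0 - q j 0); have := sqr_ge0 (q i 0 - p j 0).
  move=> *; split; apply/andP; split; nra.
have -> : ip p (Tr *m p - Ti *m q) + ip q (Tr *m q + Ti *m p) =
    \sum_i \sum_j (Tr i j * (p i 0 * p j 0 + q i 0 * q j 0) +
                   Ti i j * (q i 0 * p j 0 - p i 0 * q j 0)).
  rewrite !ip_lin !ipE -sumrB -big_split -big_split /=; apply: eq_bigr => i _.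
  rewrite !big_ord1 !mxE !mulr_sumr -sumrB -big_split -big_split /=.
  apply: eq_bigr => j _; ring.
(* Below the diagonal the entries are bounded by [d] times those of [T]; on it
   the imaginary parts cancel. *)
apply: (@le_trans _ _ (\sum_i \sum_j ((i == j)%:R * (- a * (p i 0 ^+ 2 + q i 0 ^+ 2)) + d * c i j * N))).
  apply: ler_sum => i _; apply: ler_sum => j _; rewrite !mxE.
  have [E1 E2] := entry i j.
  case: (ltngtP i j) => [ij|ji|/val_inj ->].
  - rewrite Ttrig //= !mulr0 !mul0r addr0.
    rewrite (_ : (i == j) = false) ?mul0r ?add0r; last by apply/negbTE; rewrite neq_ltn ij.
    by rewrite !mulr_ge0 // ltW.
  - rewrite (_ : (i == j) = false) ?mul0r ?add0r; last by apply/negbTE; rewrite neq_ltn ji orbT.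
    rewrite -!mulrA -mulrDr; apply: le_trans (_ : s i j * (c i j * N) <= _); last first.
      by rewrite ler_wpM2r ?sd // mulr_ge0 // ltW.
    apply: ler_wpM2l => //; rewrite mulrDl; apply: lerD.
      by apply: le_trans (ler_norm _) _; rewrite normrM ler_wpM2l.
    by apply: le_trans (ler_norm _) _; rewrite normrM ler_wpM2l.
  - rewrite eqxx s1 !mul1r (mulrC (q j 0) (p j 0)) subrr mulr0 addr0.
    rewrite -!expr2; apply: (@le_trans _ _ (- a * (p j 0 ^+ 2 + q j 0 ^+ 2))); last first.
      by rewrite lerDl !mulr_ge0 // ltW.
    by rewrite ler_wpM2r ?addr_ge0 ?sqr_ge0 // lerNr.
rewrite (eq_bigr (fun i => (- a * (p i 0 ^+ 2 + q i 0 ^+ 2)) + d * N * \sum_j c i j)); last first.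
  move=> i _; rewrite big_split /= -mulr_suml (bigD1 i) //= eqxx big1 ?addr0 ?mul1r; last first.
    by move=> j /negPf; rewrite eq_sym => ->.
  by congr (_ + _); rewrite mulr_sumr; apply: eq_bigr => j _; ring.
rewrite big_split /= -!mulr_sumr -NE -/cs.
have dCN := ler_wpM2r (ltW N0) dC.
rewrite (_ : - (a / 2) * N = - a * N + a / 2 * N); last by field.
by rewrite lerD2l mulrAC.
Qed.

End HurwitzCertificate.

(** * The Lyapunov equation *)

Section Lyapunov.
Variable F : realType.

Definition lyap n (M X : 'M[F]_n) : 'M[F]_n := M^T *m X + X *m M.

Lemma lyapD n (M X Y : 'M[F]_n) : lyap M (X + Y) = lyap M X + lyap M Y.
Proof. by rewrite /lyap mulmxDr mulmxDl addrACA. Qed.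

Lemma lyapZ n a (M X : 'M[F]_n) : lyap M (a *: X) = a *: lyap M X.
Proof. by rewrite /lyap -scalemxAr -scalemxAl scalerDr. Qed.

Lemma lyapN n (M X : 'M[F]_n) : lyap M (- X) = - lyap M X.
Proof. by rewrite -scaleN1r lyapZ scaleN1r. Qed.

Lemma lyap_form n (M X : 'M[F]_n) (x : 'cV[F]_n) : X^T = X ->
  ip x (lyap M X *m x) = 2 * ip (X *m x) (M *m x).
Proof.
move=> sX; rewrite /lyap mulmxDl ipDr -!mulmxA -ipMl ipC.
by rewrite -{2}sX -ipMl mulr2n mulrDl mul1r.
Qed.

(** At an extremal generalized eigenvector, [X *m x = mu *: (H *m x)], the form of
    [lyap M X] is [mu] times that of [lyap M H], which is negative. This relates
    the sign of [X], which is that of the smallest [mu], to the sign of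
    [lyap M X]. *)
Lemma lyap_extremal n (M H X : 'M[F]_n) : (0 < n)%N -> certificate M H -> X^T = X ->
  exists mu : F, exists x : 'cV[F]_n,
    [/\ x != 0, ip x (lyap M X *m x) = 2 * mu * ip x (H *m M *m x)
      & forall y : 'cV[F]_n, mu * ip y (H *m y) <= ip y (X *m y)].
Proof.
move=> n0 [sH H0 HM] sX.
have [mu [x [x0 Xx muH]]] := rayleigh n0 sX sH H0.
exists mu, x; split => //.
by rewrite lyap_form // Xx ipZl mulrA ipMl sH mulmxA.
Qed.

Lemma lyap_nn n (M X : 'M[F]_n) : hurwitz M -> X^T = X ->
  nnform (- lyap M X) -> nnform X.
Proof.
case: n M X => [|n] M X hM sX N0 y; first by rewrite (flatmx0 y) ip0l.
have [H cH] := hurwitz_certificate hM.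
have [mu [x [x0 E muH]]] := lyap_extremal (ltn0Sn n) cH sX.
case: cH => sH H0 HM; apply: le_trans (muH y).
rewrite mulr_ge0 ?posform_nn // leNgt; apply/negP => mu0.
by have := N0 x; rewrite mulNmx ipNr E; have := HM x x0; move: mu0; clear; nra.
Qed.

Lemma lyap_pos n (M X : 'M[F]_n) : hurwitz M -> X^T = X ->
  posform (- lyap M X) -> posform X.
Proof.
case: n M X => [|n] M X hM sX N0 y y0; first by rewrite (flatmx0 y) eqxx in y0.
have [H cH] := hurwitz_certificate hM.
have [mu [x [x0 E muH]]] := lyap_extremal (ltn0Sn n) cH sX.
case: cH => sH H0 HM; apply: lt_le_trans (muH y).
rewrite mulr_gt0 ?H0 // ltNge; apply/negP => mu0.
by have := N0 x x0; rewrite mulNmx ipNr E; have := HM x x0; move: mu0; clear; nra.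
Qed.

Lemma form_eq0 n (X : 'M[F]_n) : X^T = X -> (forall x : 'cV[F]_n, ip x (X *m x) = 0) -> X = 0.
Proof.
move=> sX X0; apply/matrixP => i j; rewrite mxE.
have : X *m (delta_mx j 0 : 'cV[F]_n) = 0.
  by apply: nnform_null => // x; rewrite X0.
by move/matrixP => /(_ i 0); rewrite -colE !mxE.
Qed.

Lemma lyap_tr n (M X : 'M[F]_n) : (lyap M X)^T = lyap M X^T.
Proof. by rewrite /lyap linearD /= !trmx_mul trmxK addrC. Qed.

(** The sign argument only speaks of symmetric matrices; an arbitrary [X] is
    the corner of the symmetric block matrix [0 X; X^T 0], which solves the
    equation for the doubled system. *)
Lemma lyap_inj n (M X : 'M[F]_n) : hurwitz M -> lyap M X = 0 -> X = 0.
Proof.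
move=> hM MX; have [H [sH H0 HM]] := hurwitz_certificate hM.
pose M2 := block_mx M 0 0 M; pose X2 := block_mx 0 X X^T 0.
pose H2 := block_mx H 0 0 H.
have hM2 : hurwitz M2.
  apply: (@certificate_hurwitz _ _ _ H2).
  have blockE (u v : 'M[F]_n) (x : 'cV[F]_(n + n)) : 
      ip x (block_mx u 0 0 v *m x) =
      ip (usubmx x) (u *m usubmx x) + ip (dsubmx x) (v *m dsubmx x).
    rewrite -{1 2}[x]vsubmxK mul_block_col !mul0mx addr0 add0r.
    by rewrite !ip_cV tr_col_mx mul_row_col mxE.
  have sub0 (x : 'cV[F]_(n + n)) : x != 0 -> (usubmx x != 0) || (dsubmx x != 0).
    move=> x0; rewrite -negb_and; apply: contra_neqN x0 => /andP [/eqP u0 /eqP d0].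
    by rewrite -[x]vsubmxK u0 d0 col_mx0.
  have Hn := posform_nn H0.
  have HMn (y : 'cV[F]_n) : ip y (H *m M *m y) <= 0.
    by have [->|y0] := eqVneq y 0; [rewrite mulmx0 ip0r|exact: ltW (HM y y0)].
  split=> [|x /sub0 /orP xs|x /sub0 /orP xs].
  - by rewrite /H2 tr_block_mx !trmx0 sH.
  - rewrite /H2 blockE; case: xs => [u0|d0].
      by rewrite ltr_wpDr ?Hn ?H0.
    by rewrite ltr_wpDl ?Hn ?H0.
  - rewrite /H2 /M2 mulmx_block !(mulmx0, mul0mx, addr0, add0r) blockE.
    case: xs => [u0|d0]; first by have := HM _ u0; have := HMn (dsubmx x); lra.
    by have := HM _ d0; have := HMn (usubmx x); lra.
have sX2 : X2^T = X2 by rewrite /X2 tr_block_mx !trmx0 trmxK.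
have MX2 : lyap M2 X2 = 0.
  rewrite /lyap /M2 /X2 tr_block_mx !mulmx_block !(trmx0, mulmx0, mul0mx, addr0, add0r).
  rewrite add_block_mx !(addr0, add0r) -/(lyap M X) -/(lyap M X^T) -lyap_tr MX.
  by rewrite trmx0 -[LHS]/(block_mx 0 0 0 0) block_mx0.
have X20 : X2 = 0.
  apply: form_eq0 => // x; apply/eqP; rewrite eq_le; apply/andP; split; last first.
    by apply: (lyap_nn hM2 sX2) => y; rewrite MX2 oppr0 mul0mx ip0r.
  rewrite -oppr_ge0 -ipNr -mulNmx; apply: (lyap_nn hM2); first by rewrite linearN /= sX2.
  by move=> y; rewrite lyapN MX2 !oppr0 mul0mx ip0r.
by have := congr1 ursubmx X20; rewrite block_mxKur => ->; apply/matrixP => i j; rewrite !mxE.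
Qed.

Lemma lyap_surj n (M N : 'M[F]_n) : hurwitz M -> exists X, lyap M X = N.
Proof.
move=> hM; pose A := lin_mx (mulmx M^T) + lin_mx (mulmxr M) : 'M[F]_(n * n).
have AE X : mxvec X *m A = mxvec (lyap M X).
  by rewrite mulmxDr !mul_vec_lin /= -linearD.
have Au : A \in unitmx.
  rewrite -row_free_unit; apply: inj_row_free => v vA.
  have := AE (vec_mx v); rewrite vec_mxK vA => /esym /eqP.
  by rewrite mxvec_eq0 => /eqP /(lyap_inj hM) v0; rewrite -[v]vec_mxK v0 linear0.
exists (vec_mx (mxvec N *m invmx A)).
by apply: (can_inj mxvecK); rewrite -AE vec_mxK mulmxKV.
Qed.

Lemma lyap_solP n (M N : 'M[F]_n) : hurwitz M -> lyap M (lyapunov_sol M N) = - N.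
Proof.
move=> hM; have [X MX] := lyap_surj (- N) hM.
have := @xgetPex _ 0 [set X | M^T *m X + X *m M + N = 0].
rewrite -/(lyapunov_sol M N) /= => /(_ _)/eqP; rewrite addr_eq0 => H; apply/eqP/H.
by exists X; rewrite -/(lyap M X) MX addNr.
Qed.

Lemma lyap_sol_uniq n (M N X : 'M[F]_n) : hurwitz M -> lyap M X = - N ->
  lyapunov_sol M N = X.
Proof.
move=> hM MX; apply/eqP; rewrite -subr_eq0; apply/eqP/(lyap_inj hM).
by rewrite lyapD lyapN MX lyap_solP // subrr.
Qed.

Lemma lyap_sol_sym n (M N : 'M[F]_n) : hurwitz M -> N^T = N ->
  (lyapunov_sol M N)^T = lyapunov_sol M N.
Proof.
move=> hM sN; apply/esym/lyap_sol_uniq => //.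
by rewrite -lyap_tr lyap_solP // linearN /= sN.
Qed.

Lemma lyap_sol_nn n (M N : 'M[F]_n) : hurwitz M -> N^T = N -> nnform N ->
  nnform (lyapunov_sol M N).
Proof.
by move=> hM sN N0; apply: (lyap_nn hM); rewrite ?lyap_sol_sym ?lyap_solP ?opprK.
Qed.

Lemma lyap_sol_pos n (M N : 'M[F]_n) : hurwitz M -> N^T = N -> posform N ->
  posform (lyapunov_sol M N).
Proof.
by move=> hM sN N0; apply: (lyap_pos hM); rewrite ?lyap_sol_sym ?lyap_solP ?opprK.
Qed.

Lemma lyap_sol_lin n (M N1 N2 : 'M[F]_n) a b : hurwitz M ->
  lyapunov_sol M (a *: N1 + b *: N2) =
  a *: lyapunov_sol M N1 + b *: lyapunov_sol M N2.
Proof.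
move=> hM; apply: lyap_sol_uniq => //.
by rewrite lyapD !lyapZ !lyap_solP // !scalerN opprD.
Qed.

(** The operator [lyap M^T] is the adjoint of [lyap M]. *)
Lemma lyap_sol_dual n (M N N' : 'M[F]_n) : hurwitz M ->
  ip (lyapunov_sol M N) N' = ip N (lyapunov_sol M^T N').
Proof.
move=> hM; set X := lyapunov_sol M N; set Y := lyapunov_sol M^T N'.
have NX : N = - lyap M X by rewrite lyap_solP // opprK.
have NY : N' = - lyap M^T Y by rewrite (lyap_solP _ (hurwitz_tr hM)) opprK.
clearbody X Y; rewrite NX NY.
by rewrite /lyap ipNl ipNr ipDl ipDr trmxK ipMl trmxK ipMr.
Qed.

Lemma ip1r n (X : 'M[F]_n) : ip X 1%:M = \tr X.
Proof. by rewrite /ip mulmx1 mxtrace_tr. Qed.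

Lemma lyap_sol_monotone n (M N1 N2 : 'M[F]_n) : hurwitz M -> N1^T = N1 -> N2^T = N2 ->
  (forall x : 'cV[F]_n, ip x (N1 *m x) <= ip x (N2 *m x)) ->
  forall x : 'cV[F]_n, ip x (lyapunov_sol M N1 *m x) <= ip x (lyapunov_sol M N2 *m x).
Proof.
move=> hM s1 s2 N12 x; rewrite -subr_ge0 -ipNr -ipDr -mulNmx -mulmxDl.
have -> : lyapunov_sol M N2 - lyapunov_sol M N1 = lyapunov_sol M (N2 - N1).
  by have := lyap_sol_lin N2 N1 1 (-1) hM; rewrite !scale1r !scaleN1r.
apply: lyap_sol_nn => // [|y]; first by rewrite linearB /= s1 s2.
by rewrite mulmxBl !ip_lin subr_ge0.
Qed.

Lemma trace_form n (X : 'M[F]_n) :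
  \tr X = \sum_i ip (delta_mx i 0 : 'cV[F]_n) (X *m delta_mx i 0).
Proof.
apply: eq_bigr => i _; rewrite ipE (bigD1 i) //= big_ord1 mxE !eqxx mul1r.
rewrite -colE mxE big1 ?addr0 // => k /negPf k0.
by rewrite big_ord1 mxE k0 mul0r.
Qed.

Lemma trace_le n (X Y : 'M[F]_n) :
  (forall x : 'cV[F]_n, ip x (X *m x) <= ip x (Y *m x)) -> \tr X <= \tr Y.
Proof. by move=> XY; rewrite !trace_form; apply: ler_sum. Qed.

Lemma trace_nn n (X : 'M[F]_n) : nnform X -> 0 <= \tr X.
Proof. by move=> X0; rewrite trace_form; apply: sumr_ge0. Qed.

(** The Cauchy-Schwarz inequality for a possibly degenerate form; a null vector
    [y] lies in the kernel. *)
Lemma form_CS n (X : 'M[F]_n) (x y : 'cV[F]_n) : X^T = X -> nnform X ->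
  ip x (X *m y) ^+ 2 <= ip x (X *m x) * ip y (X *m y).
Proof.
move=> sX X0; have [y0|y0] := eqVneq (ip y (X *m y)) 0.
  by rewrite y0 (nnform_null sX X0 y0) ip0r expr0n mulr0.
have yy : 0 < ip y (X *m y) by rewrite lt_def y0 X0.
have yx : ip y (X *m x) = ip x (X *m y) by rewrite ipC ipMl sX.
have := X0 (x - (ip x (X *m y) / ip y (X *m y)) *: y).
rewrite mulmxDr mulmxN -scalemxAr !ip_lin yx => H.
rewrite -subr_ge0 -(pmulr_rge0 _ (_ : 0 < (ip y (X *m y))^-1)) ?invr_gt0 //.
by apply: le_trans H _; rewrite le_eqVlt; apply/orP; left; apply/eqP; field.
Qed.

(** By Cauchy-Schwarz for the form, each entry squared is at most the product of
    the two diagonal entries. *)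
Lemma fro_le_trace n (X : 'M[F]_n) : X^T = X -> nnform X -> frobenius X <= \tr X.
Proof.
move=> sX X0; rewrite -ler_sqr ?nnegrE ?fro_ge0 ?trace_nn // fro_sq ipE.
have entry i j : X i j = ip (delta_mx i 0 : 'cV[F]_n) (X *m delta_mx j 0).
  rewrite ipE (bigD1 i) //= big_ord1 mxE !eqxx mul1r -colE mxE big1 ?addr0 // => k /negPf k0.
  by rewrite big_ord1 mxE k0 mul0r.
rewrite expr2 {1}/mxtrace mulr_suml; apply: ler_sum => i _.
rewrite /mxtrace mulr_sumr; apply: ler_sum => j _.
by rewrite -expr2 !entry form_CS.
Qed.

Lemma form_le_trace n (X : 'M[F]_n) (x : 'cV[F]_n) : X^T = X -> nnform X ->
  frobenius (X *m x) <= \tr X * frobenius x.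
Proof.
move=> sX X0; apply: le_trans (fro_op _ _) _.
by rewrite ler_wpM2r ?fro_ge0 // fro_le_trace.
Qed.

End Lyapunov.

(** * Exact increments of the LQR cost *)

Section LQRCost.
Variables (F : realType) (n m : nat).
Variables (A : 'M[F]_n) (B : 'M[F]_(n, m)) (Q : 'M[F]_n) (R : 'M[F]_m).
Hypotheses (n_gt0 : (0 < n)%N) (m_gt0 : (0 < m)%N).
Hypotheses (posQ : sym_posdef Q) (posR : sym_posdef R).
Implicit Types K E : 'M[F]_(m, n).

Local Notation G := (stabilizing_gains A B).
Local Notation P := (lqr_P A B Q R).
Local Notation Y := (lqr_Y A B).
Local Notation J := (lqr_J A B Q R).
Local Notation b := (spectral_norm B).
Local Notation r := (spectral_norm R).
Local Notation q := (lambda_min Q).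
Local Notation rho := (lambda_min R).

Definition closed_loop K : 'M[F]_n := A - B *m K.
Local Notation cl := closed_loop.
Definition stage_cost K : 'M[F]_n := Q + K^T *m R *m K.
(** The gradient is twice this matrix times [Y K]; it vanishes when [K] equals
    the improved gain [invmx R *m B^T *m P K]. *)
Definition gain_residual K : 'M[F]_(m, n) := R *m K - B^T *m P K.
Local Notation M := gain_residual.

Lemma lambda_min_Q_gt0 : 0 < q. Proof. by have [] := lambda_minP n_gt0 posQ. Qed.
Lemma lambda_min_R_gt0 : 0 < rho. Proof. by have [] := lambda_minP m_gt0 posR. Qed.
Lemma Q_lower (x : 'cV[F]_n) : q * ip x x <= ip x (Q *m x).
Proof. by have [_] := lambda_minP n_gt0 posQ; apply. Qed.
Lemma R_lower (x : 'cV[F]_m) : rho * ip x x <= ip x (R *m x).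
Proof. by have [_] := lambda_minP m_gt0 posR; apply. Qed.
Lemma Q_sym : Q^T = Q. Proof. by case: posQ. Qed.
Lemma R_sym : R^T = R. Proof. by case: posR. Qed.
Lemma R_nn : nnform R. Proof. by apply: posform_nn; case/sym_posdefE: posR. Qed.

Lemma stage_cost_sym K : (stage_cost K)^T = stage_cost K.
Proof. by rewrite /stage_cost linearD /= Q_sym !trmx_mul trmxK R_sym mulmxA. Qed.

Lemma stage_costE K (x : 'cV[F]_n) :
  ip x (stage_cost K *m x) = ip x (Q *m x) + ip (K *m x) (R *m (K *m x)).
Proof. by rewrite /stage_cost mulmxDl ipDr -!mulmxA -ipMl. Qed.

Lemma stage_cost_lower K (x : 'cV[F]_n) : q * ip x x <= ip x (stage_cost K *m x).
Proof. by rewrite stage_costE; have := Q_lower x; have := R_nn (K *m x); lra. Qed.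

Lemma stage_cost_pos K : posform (stage_cost K).
Proof.
move=> x x0; apply: lt_le_trans (stage_cost_lower K x).
by rewrite mulr_gt0 ?lambda_min_Q_gt0 ?ip_gt0.
Qed.

Lemma lqr_P_eq K : G K -> lyap (cl K) (P K) = - stage_cost K.
Proof. exact: lyap_solP. Qed.

Lemma lqr_P_sym K : G K -> (P K)^T = P K.
Proof. by move=> GK; apply: lyap_sol_sym => //; exact: stage_cost_sym. Qed.

Lemma lqr_P_pos K : G K -> posform (P K).
Proof.
move=> GK; apply: lyap_sol_pos => //; [exact: stage_cost_sym|exact: stage_cost_pos].
Qed.

Lemma lqr_P_nn K : G K -> nnform (P K).
Proof. by move=> GK; exact/posform_nn/lqr_P_pos. Qed.

Lemma lqr_J_gt0 K : G K -> 0 < J K.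
Proof.
move=> GK; rewrite /lqr_J trace_form (bigD1 (Ordinal n_gt0)) //=.
rewrite ltr_wpDr //; first by apply: sumr_ge0 => i _; exact: lqr_P_nn.
apply: lqr_P_pos => //; apply/eqP => /matrixP /(_ (Ordinal n_gt0) 0) /eqP.
by rewrite !mxE !eqxx oner_eq0.
Qed.

Lemma lqr_Y_eq K : G K -> lyap (cl K)^T (Y K) = - 1%:M.
Proof. by move=> GK; apply: (lyap_solP _ (hurwitz_tr GK)). Qed.

Lemma lqr_Y_sym K : G K -> (Y K)^T = Y K.
Proof. by move=> GK; apply: (lyap_sol_sym (hurwitz_tr GK)); exact: trmx1. Qed.

Lemma lqr_Y_pos K : G K -> posform (Y K).
Proof.
by move=> GK; apply: (lyap_sol_pos (hurwitz_tr GK)); [exact: trmx1|exact: posform1].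
Qed.

Lemma lqr_Y_nn K : G K -> nnform (Y K).
Proof. by move=> GK; exact/posform_nn/lqr_Y_pos. Qed.

Lemma trace_lyap_sol K N : G K -> \tr (lyapunov_sol (cl K) N) = ip N (Y K).
Proof. by move=> GK; rewrite -ip1r (lyap_sol_dual _ _ GK). Qed.

Lemma ip_Y_monotone K N1 N2 : G K -> N1^T = N1 -> N2^T = N2 ->
  (forall x : 'cV[F]_n, ip x (N1 *m x) <= ip x (N2 *m x)) ->
  ip N1 (Y K) <= ip N2 (Y K).
Proof.
move=> GK s1 s2 N12; rewrite -!trace_lyap_sol //.
by apply: trace_le; exact: lyap_sol_monotone.
Qed.

Lemma lqr_J_dual K : G K -> J K = ip (stage_cost K) (Y K).
Proof. by move=> GK; rewrite -trace_lyap_sol. Qed.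

(** The cost dominates [q] times the identity, and pairing with [Y] is monotone. *)
Lemma trace_Y_le K : G K -> \tr (Y K) <= J K / q.
Proof.
move=> GK; rewrite ler_pdivlMr ?lambda_min_Q_gt0 // mulrC lqr_J_dual // -ip1r ipC -ipZl.
apply: ip_Y_monotone => //; first by rewrite linearZ /= trmx1.
  exact: stage_cost_sym.
by move=> x; rewrite -scalemxAl mul1mx ipZr stage_cost_lower.
Qed.

Lemma fro_Y_le K : G K -> frobenius (Y K) <= J K / q.
Proof.
move=> GK; apply: le_trans (trace_Y_le GK).
by apply: fro_le_trace; [exact: lqr_Y_sym|exact: lqr_Y_nn].
Qed.

Lemma lqr_P_op K (x : 'cV[F]_n) : G K -> frobenius (P K *m x) <= J K * frobenius x.
Proof. by move=> GK; apply: form_le_trace; [exact: lqr_P_sym|exact: lqr_P_nn]. Qed.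

(** Moving the gain changes the closed loop and the stage cost; for the old [P]
    the equation of the new gain is violated exactly by this quadratic
    polynomial in the increment. *)
Lemma lyap_increment K E : G K ->
  lyap (cl (K + E)) (P K) + stage_cost (K + E) =
  E^T *m M K + (M K)^T *m E + E^T *m R *m E.
Proof.
move=> GK; have E1 : cl (K + E) = cl K - B *m E.
  by rewrite /cl mulmxDr opprD addrA.
have trD : (K + E)^T = K^T + E^T by rewrite linearD.
have E2 : stage_cost (K + E) = stage_cost K +
    (K^T *m R *m E + E^T *m R *m K + E^T *m R *m E).
  rewrite /stage_cost trD mulmxDr !mulmxDl.
  move: (K^T *m _ *m _) (E^T *m _ *m K) (K^T *m _ *m E) (E^T *m _ *m E) => t1 t2 t3 t4.
  by apply/matrixP => i j; rewrite !mxE; ring.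
have trB : (cl K - B *m E)^T = (cl K)^T - E^T *m B^T.
  by rewrite linearB /= trmx_mul.
have E3 : lyap (cl K - B *m E) (P K) = lyap (cl K) (P K)
    - (E^T *m B^T *m P K + P K *m B *m E).
  rewrite /lyap trB mulmxBl mulmxBr (mulmxA (P K)).
  move: ((cl K)^T *m _) (P K *m cl K) (E^T *m _ *m _) (P K *m _ *m _) => t1 t2 t3 t4.
  by apply/matrixP => i j; rewrite !mxE; ring.
have E4 : (M K)^T = K^T *m R - P K *m B.
  by rewrite /M linearB /= !trmx_mul trmxK (lqr_P_sym GK) R_sym.
rewrite E1 E2 E3 (lqr_P_eq GK) E4 /M mulmxBr mulmxBl !mulmxA.
move: (stage_cost K) (K^T *m _ *m E) (E^T *m _ *m K) (E^T *m R *m E)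
  (E^T *m _ *m P K) (P K *m _ *m E) => t1 t2 t3 t4 t5 t6.
by apply/matrixP => i j; rewrite !mxE; ring.
Qed.

Definition residual_form K E : 'M[F]_n := E^T *m M K + (M K)^T *m E.
Local Notation N1 := residual_form.

Lemma residual_form_sym K E : (N1 K E)^T = N1 K E.
Proof. by rewrite /residual_form linearD /= !trmx_mul !trmxK addrC. Qed.

Lemma residual_formE K E (x : 'cV[F]_n) :
  ip x (N1 K E *m x) = 2 * ip (E *m x) (M K *m x).
Proof.
rewrite /residual_form mulmxDl ipDr -!mulmxA -!ipMl (ipC (M K *m x)).
by rewrite mulr2n mulrDl mul1r.
Qed.

Lemma quad_cost_sym E : (E^T *m R *m E)^T = E^T *m R *m E.
Proof. by rewrite !trmx_mul trmxK R_sym mulmxA. Qed.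

Lemma quad_costE E (x : 'cV[F]_n) :
  ip x (E^T *m R *m E *m x) = ip (E *m x) (R *m (E *m x)).
Proof. by rewrite -!mulmxA -ipMl. Qed.

Lemma lqr_P_diff K E : G K -> G (K + E) ->
  P (K + E) - P K = lyapunov_sol (cl (K + E)) (N1 K E + E^T *m R *m E).
Proof.
move=> GK GK'; apply/esym/(lyap_sol_uniq GK').
rewrite lyapD lyapN (lqr_P_eq GK') -(lyap_increment _ GK).
by rewrite [RHS]opprD addrC.
Qed.

(** The new gain enters only through its correlation matrix, so the sign of the
    increment polynomial as a form is the sign of the cost difference. *)
Lemma lqr_J_diff K E : G K -> G (K + E) ->
  J (K + E) - J K = ip (N1 K E) (Y (K + E)) + ip (E^T *m R *m E) (Y (K + E)).
Proof.
move=> GK GK'; rewrite -ipDl -(trace_lyap_sol _ GK') -(lqr_P_diff GK GK').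
by rewrite linearB.
Qed.

Lemma ip_residual_form K E (Z : 'M[F]_n) : Z^T = Z ->
  ip (N1 K E) Z = 2 * ip (M K *m Z) E.
Proof.
move=> sZ; rewrite /residual_form ipDl.
have -> : ip (E^T *m M K) Z = ip (M K *m Z) E by rewrite ipMl trmxK [RHS]ipMr sZ.
have -> : ip ((M K)^T *m E) Z = ip (M K *m Z) E by rewrite ipMl trmxK ipC.
by rewrite mulr2n mulrDl mul1r.
Qed.

Lemma ip_residual_Y K E : G K -> ip (N1 K E) (Y K) = ip (lqr_grad A B Q R K) E.
Proof. by move=> GK; rewrite ip_residual_form ?lqr_Y_sym // ipZl. Qed.

Definition residual_sol K E : 'M[F]_n := lyapunov_sol (cl K) (N1 K E).
Local Notation S := residual_sol.

Lemma residual_sol_sym K E : G K -> (S K E)^T = S K E.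
Proof. by move=> GK; apply: lyap_sol_sym => //; exact: residual_form_sym. Qed.

(** The duality of the two Lyapunov equations turns the change of the correlation
    matrix into a second factor [E], so the expansion is exact with a remainder
    quadratic in [E]. *)
Lemma lqr_J_taylor K E : G K -> G (K + E) ->
  J (K + E) - J K = ip (lqr_grad A B Q R K) E
    + ip (R *m (E *m Y (K + E))) E
    - 2 * ip (B^T *m (S K E *m Y (K + E))) E.
Proof.
move=> GK GK'; rewrite (lqr_J_diff GK GK').
have -> : ip (E^T *m R *m E) (Y (K + E)) = ip (R *m (E *m Y (K + E))) E.
  by rewrite -mulmxA ipMl trmxK [RHS]ipMl R_sym [RHS]ipC.
have -> : ip (N1 K E) (Y (K + E)) =
    ip (lqr_grad A B Q R K) E + ip (N1 K E) (Y (K + E) - Y K).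
  by rewrite -ip_residual_Y // -ipDr (addrC (Y K)) subrK.
rewrite addrAC; congr (_ + _ + _).
have -> : N1 K E = - lyap (cl K) (S K E) by rewrite (lyap_solP _ GK) opprK.
have dual (X Z : 'M[F]_n) : ip (lyap (cl K) X) Z = ip X (lyap (cl K)^T Z).
  by rewrite /lyap ipDl ipDr trmxK ipMl trmxK ipMr.
rewrite ipNl dual lyapD lyapN (lqr_Y_eq GK).
have -> : lyap (cl K)^T (Y (K + E)) =
    - 1%:M + (B *m E *m Y (K + E) + Y (K + E) *m (B *m E)^T).
  rewrite -(lqr_Y_eq GK') /lyap !trmxK.
  have -> : cl (K + E) = cl K - B *m E by rewrite /cl mulmxDr opprD addrA.
  have trB : (cl K - B *m E)^T = (cl K)^T - (B *m E)^T by rewrite linearB.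
  rewrite trB [(cl K - B *m E) *m _]mulmxBl mulmxBr.
  move: (cl K *m _) (B *m E *m _) (Y _ *m (cl K)^T) (Y _ *m (B *m E)^T) => t1 t2 t3 t4.
  by apply/matrixP => i j; rewrite !mxE; ring.
rewrite addrAC subrr add0r ipDr.
have -> : ip (S K E) (Y (K + E) *m (B *m E)^T) = ip (S K E) (B *m E *m Y (K + E)).
  by rewrite -ip_tr trmx_mul trmxK (lqr_Y_sym GK') (residual_sol_sym _ GK).
have -> : ip (B^T *m (S K E *m Y (K + E))) E = ip (S K E) (B *m E *m Y (K + E)).
  by rewrite ipMl trmxK ipMr (lqr_Y_sym GK').
lra.
Qed.

(** * Bounds on a sublevel set *)

(** The positive root estimate for [k ^+ 2 <= a2 ^+ 2 * h + a1 * h * k], with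
    [a1] and [a2] the constants in the definition of [lqr_L]. *)
Definition gain_bound (h : F) : F :=
  2 * b / rho * h + Num.sqrt (2 * spectral_norm A / rho) * Num.sqrt h.

Lemma gain_bound_ge0 h : 0 <= h -> 0 <= gain_bound h.
Proof.
move=> h0; rewrite addr_ge0 ?mulr_ge0 ?sqrtr_ge0 ?spectral_norm_ge0 ?invr_ge0 //.
exact/ltW/lambda_min_R_gt0.
Qed.

Lemma quadratic_bound (k u v : F) : 0 <= u -> 0 <= v -> k ^+ 2 <= v ^+ 2 + u * k ->
  k <= u + v.
Proof.
move=> u0 v0 H; rewrite leNgt; apply/negP => kuv.
have k1 : v < k - u by lra.
have k2 : v < k by lra.
have : v * v <= v * (k - u) by rewrite ler_wpM2l // ltW.
have : v * (k - u) < k * (k - u) by rewrite ltr_pM2r // (le_lt_trans v0).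
rewrite !expr2 in H; lra.
Qed.

(** Test the Lyapunov equation of [P] with [x]: the stage cost dominates
    [lambda_min R] times the square of [K *m x], and the other side grows only
    linearly in [K]. *)
Lemma gain_op K : G K -> spectral_norm K <= gain_bound (J K).
Proof.
move=> GK; set h := J K; have h0 : 0 < h by exact: lqr_J_gt0.
set k := spectral_norm K; have k0 : 0 <= k by exact: spectral_norm_ge0.
set al := spectral_norm A; have al0 : 0 <= al by exact: spectral_norm_ge0.
have b0 : 0 <= b by exact: spectral_norm_ge0.
have rp := lambda_min_R_gt0; have qp := lambda_min_Q_gt0.
have step (x : 'cV[F]_n) : frobenius x <= 1 ->
    frobenius (K *m x) <= Num.sqrt (2 * h * (al + b * k) / rho).
  move=> x1; have fx := fro_ge0 x.
  rewrite -[leLHS](ger0_norm (fro_ge0 _)) -sqrtr_sqr ler_wsqrtr //.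
  rewrite ler_pdivlMr // fro_sq mulrC.
  have H1 := R_lower (K *m x); have H2 := Q_lower x.
  have H3 : 0 <= q * ip x x by rewrite mulr_ge0 ?ip_ge0 ?ltW.
  have H4 := stage_costE K x.
  have H5 := lyap_form (cl K) x (lqr_P_sym GK).
  rewrite (lqr_P_eq GK) mulNmx ipNr in H5.
  have H6 := ip_CSN (P K *m x) (cl K *m x).
  have H7 : frobenius (cl K *m x) <= al + b * k.
    rewrite /cl mulmxBl -mulmxA; apply: le_trans (froB _ _) _; apply: lerD.
      by apply: le_trans (spectral_norm_op _ _) _; rewrite ler_piMr.
    apply: le_trans (spectral_norm_op _ _) _; rewrite ler_wpM2l //.
    by apply: le_trans (spectral_norm_op _ _) _; rewrite ler_piMr.
  have H8 : frobenius (P K *m x) <= h.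
    by apply: le_trans (lqr_P_op x GK) _; rewrite ler_piMr // ltW.
  have H9 : frobenius (P K *m x) * frobenius (cl K *m x) <= h * (al + b * k).
    by apply: ler_pM; rewrite ?fro_ge0.
  lra.
have kle := spectral_norm_le step; rewrite -/k in kle.
apply: quadratic_bound.
- by rewrite !mulr_ge0 ?invr_ge0 // ltW.
- by rewrite mulr_ge0 ?sqrtr_ge0.
have hn := ltW h0; have rn := ltW rp.
have t0 : 0 <= 2 * h * (al + b * k) / rho.
  by rewrite divr_ge0 // mulr_ge0 ?mulr_ge0 // addr_ge0 // mulr_ge0.
apply: (@le_trans _ _ (2 * h * (al + b * k) / rho)).
  by rewrite -[leRHS]sqr_sqrtr // lerXn2r ?nnegrE ?sqrtr_ge0.
have t1 : 0 <= 2 * spectral_norm A / rho by rewrite divr_ge0 ?mulr_ge0.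
rewrite exprMn !sqr_sqrtr //.
by rewrite le_eqVlt; apply/orP; left; apply/eqP; rewrite -/al; field; rewrite gt_eqF.
Qed.

Definition residual_bound (h : F) : F := r * gain_bound h + b * h.

Lemma residual_bound_ge0 h : 0 <= h -> 0 <= residual_bound h.
Proof.
by move=> h0; rewrite addr_ge0 ?mulr_ge0 ?spectral_norm_ge0 ?gain_bound_ge0.
Qed.

Lemma BT_op (y : 'cV[F]_n) : frobenius (B^T *m y) <= b * frobenius y.
Proof. by apply: op_tr (spectral_norm_ge0 _) _ y; exact: spectral_norm_op. Qed.

Lemma residual_op K (x : 'cV[F]_n) : G K ->
  frobenius (M K *m x) <= residual_bound (J K) * frobenius x.
Proof.
move=> GK; rewrite /M mulmxBl -!mulmxA; apply: le_trans (froB _ _) _.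
rewrite /residual_bound mulrDl; apply: lerD.
  apply: le_trans (spectral_norm_op _ _) _; rewrite -mulrA.
  apply: ler_wpM2l; first exact: spectral_norm_ge0.
  apply: le_trans (spectral_norm_op _ _) _.
  by rewrite ler_wpM2r ?fro_ge0 ?gain_op.
apply: le_trans (BT_op _) _; rewrite -mulrA.
by rewrite ler_wpM2l ?spectral_norm_ge0 ?lqr_P_op.
Qed.

Lemma grad_le K : G K ->
  frobenius (lqr_grad A B Q R K) <= 2 * residual_bound (J K) * J K / q.
Proof.
move=> GK; have h0 := ltW (lqr_J_gt0 GK).
rewrite /lqr_grad froZ ger0_norm // -!mulrA ler_wpM2l //.
apply: (@le_trans _ _ (residual_bound (J K) * frobenius (Y K))).
  by apply: fro_mul_op => [|x]; [exact: residual_bound_ge0|exact: residual_op].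
by rewrite ler_wpM2l ?residual_bound_ge0 ?fro_Y_le.
Qed.

(** The residual form is at most a multiple of the stage cost, with either sign;
    by monotonicity its Lyapunov solution is at most the same multiple of [P],
    whose form is bounded by its trace [J K]. *)
Lemma residual_sol_op K E (x : 'cV[F]_n) : G K ->
  frobenius (S K E *m x) <=
  2 * frobenius E * residual_bound (J K) * J K / q * frobenius x.
Proof.
move=> GK; have h0 := ltW (lqr_J_gt0 GK).
have e0 := fro_ge0 E; have qp := lambda_min_Q_gt0; have mb0 := residual_bound_ge0 h0.
pose c := 2 * frobenius E * residual_bound (J K) / q.
have c0 : 0 <= c by rewrite divr_ge0 ?mulr_ge0 // ltW.
have N1_le (y : 'cV[F]_n) : `|ip y (N1 K E *m y)| <= c * ip y (stage_cost K *m y).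
  rewrite residual_formE normrM ger0_norm //.
  apply: (@le_trans _ _ (c * (q * ip y y))); last first.
    by rewrite ler_wpM2l ?stage_cost_lower.
  rewrite -fro_sq (_ : c * _ = 2 * ((frobenius E * frobenius y) * (residual_bound (J K) * frobenius y))).
    rewrite ler_wpM2l //; apply: (@le_trans _ _ (frobenius (E *m y) * frobenius (M K *m y))).
      by rewrite ler_norml ip_CS ip_CSN.
    by apply: ler_pM; rewrite ?fro_ge0 ?fro_op ?residual_op.
  by rewrite /c; field; rewrite gt_eqF.
have S_le (a : F) (y : 'cV[F]_n) : `|a| = 1 -> a * ip y (S K E *m y) <= c * ip y (P K *m y).
  move=> a1.
  have -> : a * ip y (S K E *m y) = ip y (lyapunov_sol (cl K) (a *: N1 K E) *m y).
    have := lyap_sol_lin (N1 K E) 0 a 0 GK; rewrite !scale0r !addr0 => ->.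
    by rewrite -scalemxAl ipZr.
  have -> : c * ip y (P K *m y) = ip y (lyapunov_sol (cl K) (c *: stage_cost K) *m y).
    have := lyap_sol_lin (stage_cost K) 0 c 0 GK; rewrite !scale0r !addr0 => ->.
    by rewrite -scalemxAl ipZr.
  apply: lyap_sol_monotone => // [||z].
  - by rewrite linearZ /= residual_form_sym.
  - by rewrite linearZ /= stage_cost_sym.
  rewrite -!scalemxAl !ipZr; apply: le_trans (ler_norm _) _.
  by rewrite normrM a1 mul1r.
have P_le (y : 'cV[F]_n) : c * ip y (P K *m y) <= c * J K * ip y y.
  rewrite -mulrA ler_wpM2l //; apply: le_trans (ip_CS _ _) _.
  by rewrite -fro_sq expr2 mulrC mulrA ler_wpM2r ?fro_ge0 ?lqr_P_op.
have -> : 2 * frobenius E * residual_bound (J K) * J K / q = c * J K.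
  by rewrite /c; field; rewrite gt_eqF.
apply: sym_form_op; first exact: residual_sol_sym.
- exact: mulr_ge0.
- by move=> y; have := S_le 1 y (normr1 _); have := P_le y; lra.
- by move=> y; have := S_le (-1) y (normrN1 _); have := P_le y; lra.
Qed.

(** The coefficient of the quadratic remainder, per unit of the new cost. *)
Definition curvature (h : F) : F := r / q + 4 * b * residual_bound h * h / q ^+ 2.

Lemma curvature_ge0 h : 0 <= h -> 0 <= curvature h.
Proof.
move=> h0; have := lambda_min_Q_gt0 => qp; rewrite addr_ge0 ?divr_ge0 ?mulr_ge0 ?exprn_ge0 //;
  by rewrite ?spectral_norm_ge0 ?residual_bound_ge0 // ltW.
Qed.

(** The exponent [5 / 2] comes from the term [Num.sqrt h] of [gain_bound]. *)
Lemma lqr_LE h : 0 <= h -> lqr_L A B Q R h = 2 * h * curvature h.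
Proof.
move=> h0; have qp := lambda_min_Q_gt0; have rp := lambda_min_R_gt0.
have -> : lqr_L A B Q R h = 2 * r / q * h
  + 8 * Num.sqrt (2 * spectral_norm A / rho) * b * r / q ^+ 2 * h `^ (5 / 2)
  + 8 * b * (2 * b / rho * r + b) / q ^+ 2 * h ^+ 3 by [].
have -> : h `^ (5 / 2) = h ^+ 2 * Num.sqrt h.
  have [->|hn0] := eqVneq h 0; first by rewrite powR0 ?expr0n ?mul0r //; lra.
  have -> : 5 / 2 = 2 + 2^-1 :> F by field.
  by rewrite powRD ?hn0 ?implybT // powR12_sqrt // -powR_mulrn.
rewrite /curvature /residual_bound /gain_bound; field.
by rewrite !gt_eqF.
Qed.

(** Each of the two quadratic traces of the expansion is bounded by operator
    norms, with [h' / q] for the correlation matrix of the new gain. *)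
Lemma J_remainder K E : G K -> G (K + E) ->
  `|J (K + E) - J K - ip (lqr_grad A B Q R K) E|
     <= curvature (J K) * J (K + E) * frobenius E ^+ 2.
Proof.
move=> GK GK'; rewrite (lqr_J_taylor GK GK').
have h0 := ltW (lqr_J_gt0 GK); have h0' := ltW (lqr_J_gt0 GK').
have e0 := fro_ge0 E; have qp := lambda_min_Q_gt0.
have b0 := spectral_norm_ge0 B; have r0 := spectral_norm_ge0 R.
have mb0 := residual_bound_ge0 h0.
have Yle := fro_Y_le GK'.
set h := J K in h0 mb0 *; set h' := J (K + E) in h0' Yle *; set e := frobenius E in e0 *.
set mb := residual_bound h in mb0 *.
have T1 : `|ip (R *m (E *m Y (K + E))) E| <= r * (h' / q) * e ^+ 2.
  apply: (@le_trans _ _ (frobenius (R *m (E *m Y (K + E))) * e)).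
    by rewrite ler_norml ip_CS ip_CSN.
  rewrite expr2 mulrA ler_wpM2r //.
  apply: (@le_trans _ _ (r * frobenius (E *m Y (K + E)))).
    by apply: fro_mul_op => // x; exact: spectral_norm_op.
  rewrite -mulrA ler_wpM2l // mulrC; apply: le_trans (fro_mul _ _) _.
  by rewrite ler_wpM2l.
have T2 : `|ip (B^T *m (S K E *m Y (K + E))) E| <= b * (2 * e * mb * h / q) * (h' / q) * e.
  apply: (@le_trans _ _ (frobenius (B^T *m (S K E *m Y (K + E))) * e)).
    by rewrite ler_norml ip_CS ip_CSN.
  rewrite ler_wpM2r //.
  apply: (@le_trans _ _ (b * frobenius (S K E *m Y (K + E)))).
    by apply: fro_mul_op => // x; exact: BT_op.
  rewrite -mulrA ler_wpM2l //.
  have s0 : 0 <= 2 * e * mb * h / q by rewrite divr_ge0 ?mulr_ge0 // ltW.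
  apply: (@le_trans _ _ (2 * e * mb * h / q * frobenius (Y (K + E)))).
    by apply: fro_mul_op => // x; exact: residual_sol_op.
  by rewrite ler_wpM2l.
set t1 := ip (R *m _) E in T1 *; set t2 := ip (B^T *m _) E in T2 *.
set g := ip (lqr_grad _ _ _ _ _) _.
have -> : g + t1 - 2 * t2 - g = t1 - 2 * t2 by ring.
apply: le_trans (ler_normB _ _) _; rewrite normrM ger0_norm //.
apply: le_trans (lerD T1 (ler_wpM2l _ T2)) _ => //.
rewrite le_eqVlt; apply/orP; left; apply/eqP.
by rewrite /curvature -/mb; field; rewrite gt_eqF.
Qed.

(** [P K] is still a certificate for the new gain: the increment perturbs the
    derivative of its form by at most [2 * J K * b * |E|], against a decay rate of
    at least [q]. *)
Lemma stable_ball K E : G K -> 2 * J K * b * frobenius E < q -> G (K + E).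
Proof.
move=> GK Eq; apply: (@certificate_hurwitz _ _ _ (P K)).
split; [exact: lqr_P_sym|exact: lqr_P_pos|move=> x x0].
have -> : A - B *m (K + E) = cl K - B *m E by rewrite /cl mulmxDr opprD addrA.
rewrite -mulmxA -[in X in ip x X](lqr_P_sym GK) -ipMl mulmxBl ipDr ipNr.
have H5 := lyap_form (cl K) x (lqr_P_sym GK).
rewrite (lqr_P_eq GK) mulNmx ipNr in H5.
have H1 := stage_cost_lower K x.
have H2 := ip_CSN (P K *m x) (B *m E *m x).
have fx := fro_gt0 x0; have h0 := lqr_J_gt0 GK.
have H3 : frobenius (P K *m x) * frobenius (B *m E *m x) <=
    (J K * frobenius x) * (b * (frobenius E * frobenius x)).
  apply: ler_pM; rewrite ?fro_ge0 ?lqr_P_op // -mulmxA.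
  apply: le_trans (spectral_norm_op _ _) _.
  by rewrite ler_wpM2l ?spectral_norm_ge0 ?fro_op.
have H4 : 2 * J K * b * frobenius E * ip x x < q * ip x x.
  by rewrite ltr_pM2r // ip_gt0.
rewrite -fro_sq in H4 H1; lra.
Qed.

(** * Continuity, compact sublevel sets and descent *)

(** The remainder estimate contains [J K'], which is first bounded by absorbing
    it: for a small increment its coefficient is at most one half. *)
Lemma J_cont K : G K -> forall e, 0 < e -> exists2 d, 0 < d &
  forall K', G K' -> frobenius (K' - K) < d -> `|J K' - J K| <= e.
Proof.
move=> GK e e0; have h0 := lqr_J_gt0 GK.
set h := J K in h0 *; set c := curvature h.
have c0 : 0 <= c by apply: curvature_ge0; exact: ltW.
pose g := frobenius (lqr_grad A B Q R K); have g0 : 0 <= g by exact: fro_ge0.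
pose T := g + c * (2 * (h + g)).
have T0 : 0 <= T by rewrite addr_ge0 // mulr_ge0 // mulr_ge0 // addr_ge0 // ltW.
have d1 : 0 < (2 * (c + 1))^-1 by rewrite invr_gt0; lra.
have d2 : 0 < e / (T + 1) by rewrite divr_gt0 //; lra.
exists (Num.min 1 (Num.min (2 * (c + 1))^-1 (e / (T + 1)))).
  by rewrite !lt_min ltr01 d1.
move=> K' GK'; rewrite !lt_min => /and3P [x1 x2 x3].
have EK : K + (K' - K) = K' by rewrite addrC subrK.
have := J_remainder GK (_ : G (K + (K' - K))); rewrite EK => /(_ GK').
have := ip_CS (lqr_grad A B Q R K) (K' - K).
have := ip_CSN (lqr_grad A B Q R K) (K' - K).
rewrite -/h -/c -/g; set x := frobenius _ in x1 x2 x3 *.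
set G1 := ip _ _; have x0 : 0 <= x by exact: fro_ge0.
have h'0 := ltW (lqr_J_gt0 GK'); set h' := J K' in h'0 *.
move=> gl gu rem.
have cx : c * x <= 2^-1.
  have x2' : x * (2 * (c + 1)) < 1 by rewrite -ltr_pdivlMr ?mul1r //; lra.
  lra.
have cxx : c * h' * x ^+ 2 <= (c * h') * x.
  by rewrite expr2 mulrA ler_piMr ?mulr_ge0 // ltW.
have gx : g * x <= g by rewrite ler_piMr // ltW.
have hx : (c * x) * h' <= 2^-1 * h' by rewrite ler_wpM2r.
have h'le : h' <= 2 * (h + g).
  by move: rem; rewrite ler_norml => /andP [_]; lra.
have cxh : (c * x) * h' <= (c * x) * (2 * (h + g)) by rewrite ler_wpM2l // mulr_ge0.
have Tx : T * x <= e.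
  have : x * (T + 1) < e by rewrite -ltr_pdivlMr //; lra.
  lra.
have TE : T * x = g * x + c * x * (2 * (h + g)) by rewrite /T; ring.
by move: rem; rewrite !ler_norml => /andP [r1 r2]; apply/andP; split; lra.
Qed.

Lemma J_continuous : {within G, continuous J}.
Proof. by apply: within_continuous_fro => X GX e e0; exact: J_cont. Qed.

Lemma gain_bound_le h h' : 0 <= h -> h <= h' -> gain_bound h <= gain_bound h'.
Proof.
move=> h0 hh'; have rn := ltW lambda_min_R_gt0.
apply: lerD; first by rewrite ler_wpM2l // divr_ge0 // mulr_ge0 // spectral_norm_ge0.
by rewrite ler_wpM2l ?sqrtr_ge0 // ler_wsqrtr.
Qed.

Lemma sublevel_bounded K h : G K -> J K <= h ->
  frobenius K <= gain_bound h * frobenius (1%:M : 'M[F]_n).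
Proof.
move=> GK Kh; have h0 := ltW (lqr_J_gt0 GK).
rewrite -[X in frobenius X <= _]mulmx1; apply: fro_mul_op.
  by apply: gain_bound_ge0; exact: le_trans Kh.
move=> x; apply: le_trans (spectral_norm_op _ _) _.
by rewrite ler_wpM2r ?fro_ge0 // (le_trans (gain_op GK)) ?gain_bound_le.
Qed.

Definition stable_radius (h : F) : F := q / (2 * h * b + 1).

Lemma stable_radius_gt0 h : 0 <= h -> 0 < stable_radius h.
Proof.
move=> h0; rewrite divr_gt0 ?lambda_min_Q_gt0 // ltr_wpDl // !mulr_ge0 //.
exact: spectral_norm_ge0.
Qed.

Lemma sublevel_ball K X h : G K -> J K <= h -> frobenius (X - K) < stable_radius h -> G X.
Proof.
move=> GK Kh XK; have h0 := ltW (lqr_J_gt0 GK).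
have b0 := spectral_norm_ge0 B; have x0 := fro_ge0 (X - K).
have -> : X = K + (X - K) by rewrite addrC subrK.
apply: stable_ball => //; move: XK; rewrite /stable_radius ltr_pdivlMr; last first.
  by rewrite ltr_wpDl // !mulr_ge0 // (le_trans h0).
have : J K * (b * frobenius (X - K)) <= h * (b * frobenius (X - K)).
  by rewrite ler_wpM2r ?mulr_ge0.
lra.
Qed.

(** Closedness comes from the uniform stability ball: a limit of gains in the
    sublevel set is within the stability radius of one of them. *)
Lemma sublevel_compact h : compact [set K | G K /\ J K <= h].
Proof.
apply: (@fro_bounded_closed_compact _ _ _ _ (gain_bound h * frobenius (1%:M : 'M[F]_n))).
  by move=> X [GX Xh]; exact: sublevel_bounded.
move=> X clX.
have near e : 0 < e -> exists K, [/\ G K, J K <= h & frobenius (K - X) < e].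
  move=> e0; have [|K [[GK Kh] KX]] := clX [set K | frobenius (K - X) < e].
    by apply/nbhs_froP; exists e.
  by exists K.
have [K1 [GK1 K1h _]] := near 1 ltr01.
have h0 : 0 <= h by apply: le_trans K1h; exact/ltW/lqr_J_gt0.
have GX : G X.
  have [K [GK Kh KX]] := near _ (stable_radius_gt0 h0).
  by apply: (sublevel_ball GK Kh); rewrite -froN opprB.
split => //; apply/ler_addgt0Pl => e e0.
have [d d0 dP] := J_cont GX e0; have [K [GK Kh KX]] := near d d0.
by have := dP K GK KX; rewrite ler_norml => /andP [H1 H2]; lra.
Qed.

Lemma J_min : stabilizable A B -> exists2 K, G K & forall K', G K' -> J K <= J K'.
Proof.
move=> [K0 GK0]; pose D := [set K | G K /\ J K <= J K0].
have DG : D `<=` G by move=> K [].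
have D0 : D !=set0 by exists K0; split.
have fc : {within D, continuous J} := continuous_subspaceW DG J_continuous.
have [K /set_mem [GK KK0] Kmin] := compact_EVT_min D0 (@sublevel_compact _) fc.
exists K => // K' GK'; have [K'0|/ltW K0'] := leP (J K') (J K0).
  by apply: Kmin; apply/mem_set; split.
exact: le_trans KK0 K0'.
Qed.

Lemma spectral_norm_R_gt0 : 0 < r.
Proof.
pose x := delta_mx (Ordinal m_gt0) 0 : 'cV[F]_m.
have x0 : x != 0.
  by apply/eqP => /matrixP /(_ (Ordinal m_gt0) 0) /eqP; rewrite !mxE !eqxx oner_eq0.
have := R_lower x; have := ip_CS x (R *m x); have := spectral_norm_op R x.
have fx := fro_gt0 x0; rewrite -fro_sq => H1 H2 H3.
have H4 : frobenius x * frobenius (R *m x) <= frobenius x * (r * frobenius x).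
  by rewrite ler_wpM2l // ltW.
have : rho * frobenius x ^+ 2 <= r * frobenius x ^+ 2 by lra.
by rewrite ler_pM2r ?exprn_gt0 //; apply: lt_le_trans lambda_min_R_gt0.
Qed.

Lemma curvature_lower h : 0 <= h -> r / q <= curvature h.
Proof.
move=> h0; have qp := lambda_min_Q_gt0; rewrite lerDl divr_ge0 ?exprn_ge0 ?mulr_ge0 //;
  by rewrite ?spectral_norm_ge0 ?residual_bound_ge0 ?(ltW qp).
Qed.

Lemma segment_continuous K E (u : F) : (forall t, 0 <= t <= 1 -> G (K + t *: E)) ->
  0 <= u -> {within `[u, 1], continuous (fun t => J (K + t *: E))}.
Proof.
move=> Gt u0; apply/subspace_continuousP => t /=; rewrite in_itv /= => /andP [ut t1].
apply/cvgrPdist_le => e e0.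
have GKt : G (K + t *: E) by apply: Gt; rewrite (le_trans u0).
have [d d0 dP] := J_cont GKt e0.
rewrite /prop_near1 /within /=; apply/nbhs_normP.
have f0 := fro_ge0 E; have f1 : 0 < frobenius E + 1 by lra.
exists (d / (frobenius E + 1)); first by rewrite /= divr_gt0.
move=> s /=; rewrite ltr_pdivlMr // => ts; rewrite in_itv /= => /andP [us s1].
rewrite distrC; apply: dP; first by apply: Gt; rewrite (le_trans u0).
have -> : K + s *: E - (K + t *: E) = (s - t) *: E.
  by rewrite scalerBl opprD addrACA subrr add0r.
rewrite froZ distrC; apply: le_lt_trans ts.
by rewrite ler_wpM2l // lerDl.
Qed.

(** The remainder estimate has the cost of the end point as a factor, so it is
    only useful where the cost has not grown. If the step increased the cost, an
    intermediate point of the segment would have the initial cost, by continuity,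
    and there the estimate gives a strict decrease. *)
Lemma perturbed_descent K W eta : G K -> 0 < eta -> eta * lqr_L A B Q R (J K) <= 1 ->
  2 * frobenius W <= frobenius (lqr_grad A B Q R K) ->
  let K' := K - eta *: (lqr_grad A B Q R K + W) in
  G K' /\ J K' <= J K - 3 / 8 * eta * frobenius (lqr_grad A B Q R K) ^+ 2.
Proof.
move=> GK eta0 etaL; set g := lqr_grad A B Q R K => Wg.
have h0 := lqr_J_gt0 GK; set h := J K in h0 etaL *.
have [g00|g00] := eqVneq g 0.
  have -> : W = 0.
    by apply/eqP; rewrite -fro_eq0 eq_le fro_ge0 andbT; move: Wg; rewrite g00 fro0; lra.
  by rewrite g00 /= addr0 scaler0 subr0 fro0 expr0n mulr0 subr0.
rewrite lqr_LE in etaL; last exact: ltW.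
set c := curvature h in etaL; have c0 : 0 <= c by apply: curvature_ge0; exact: ltW.
have b0 := spectral_norm_ge0 B; have qp := lambda_min_Q_gt0.
have mb0 := residual_bound_ge0 (ltW h0).
set D := g + W; pose E := - (eta *: D); rewrite /= -/E.
have ge := grad_le GK; rewrite -/g -/h in ge.
have g0 := fro_gt0 g00; have w0 := fro_ge0 W.
set gn := frobenius g in ge g0 Wg *; set wn := frobenius W in w0 Wg *.
have Dn : frobenius D <= 3 / 2 * gn by apply: le_trans (froD _ _) _; rewrite -/gn -/wn; lra.
have gD : ip g D = gn ^+ 2 + ip g W by rewrite /D ipDr /gn fro_sq.
have DD : frobenius D ^+ 2 = gn ^+ 2 + 2 * ip g W + wn ^+ 2.
  by rewrite fro_sq /gn /wn !fro_sq /D !ip_lin (ipC W); ring.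
have Dn0 := fro_ge0 D.
have ww : wn ^+ 2 <= gn ^+ 2 / 4.
  have : wn * wn <= (gn / 2) * (gn / 2) by apply: ler_pM => //; lra.
  by rewrite !expr2; lra.
have gn2 : 0 < gn ^+ 2 by rewrite exprn_gt0.
have g38 : 0 < 3 / 8 * gn ^+ 2 by rewrite mulr_gt0 // divr_gt0.
have En : frobenius E = eta * frobenius D by rewrite /E froN froZ gtr0_norm.
(* The second summand of the curvature is what keeps the whole segment inside the
   stability ball of [K]. *)
have Gt t : 0 <= t <= 1 -> G (K + t *: E).
  move=> /andP [t0 t1]; apply: stable_ball => //; rewrite froZ ger0_norm // En -/h.
  have x1 : t * (eta * frobenius D) <= 3 / 2 * (eta * gn).
    apply: (@le_trans _ _ (eta * frobenius D)); first by rewrite ler_piMl // mulr_ge0 // ltW.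
    by rewrite mulrCA ler_wpM2l // ltW.
  have x2 : eta * gn <= eta * (2 * residual_bound h * h / q) by rewrite ler_wpM2l // ltW.
  have x3 : 2 * h * b * (t * (eta * frobenius D)) <=
      2 * h * b * (3 / 2 * (eta * (2 * residual_bound h * h / q))).
    by rewrite ler_wpM2l ?mulr_ge0 ?(ltW h0) // (le_trans x1) // ler_wpM2l.
  apply: le_lt_trans x3 _.
  have x4 : eta * (2 * h * (4 * b * residual_bound h * h / q ^+ 2)) <= 1.
    apply: le_trans etaL; rewrite ler_wpM2l ?(ltW eta0) // ler_wpM2l ?mulr_ge0 ?(ltW h0) //.
    by rewrite lerDr divr_ge0 ?spectral_norm_ge0 ?(ltW qp).
  have -> : 2 * h * b * (3 / 2 * (eta * (2 * residual_bound h * h / q))) =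
      eta * (2 * h * (4 * b * residual_bound h * h / q ^+ 2)) * (3 / 4 * q).
    by field; rewrite gt_eqF.
  have : eta * (2 * h * (4 * b * residual_bound h * h / q ^+ 2)) * (3 / 4 * q) <= 1 * (3 / 4 * q).
    by rewrite ler_wpM2r // mulr_ge0 // ltW.
  lra.
pose f t := J (K + t *: E).
have f_ge0 t : 0 <= t <= 1 -> 0 <= f t by move=> /Gt /lqr_J_gt0 /ltW.
pose y := eta * frobenius D ^+ 2.
have y0 : 0 <= y by rewrite mulr_ge0 ?sqr_ge0 // ltW.
have est t : 0 <= t <= 1 -> f t - h <= - (t * eta * ip g D) + f t / h * (t ^+ 2 * y / 2).
  move=> t01; have /andP [t0 t1] := t01.
  have := J_remainder GK (Gt t t01); rewrite -/g -/h -/c -/(f t) ler_norml => /andP [_].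
  rewrite froZ (ger0_norm t0) En /E ipZr ipNr ipZr.
  have : c * f t * (t * (eta * frobenius D)) ^+ 2 <= f t / h * (t ^+ 2 * y / 2).
    have -> : c * f t * (t * (eta * frobenius D)) ^+ 2 =
        (eta * (2 * h * c)) * (f t / h * (t ^+ 2 * y / 2)).
      by rewrite /y; field; rewrite gt_eqF.
    have X1 : 0 <= f t / h by apply: divr_ge0; [exact: f_ge0|exact: ltW].
    have X2 : 0 <= t ^+ 2 * y / 2 by apply: divr_ge0; rewrite // mulr_ge0 ?sqr_ge0.
    by apply: ler_piMl => //; exact: mulr_ge0.
  lra.
have drop t : 0 < t <= 1 -> t * eta * ip g D - t ^+ 2 * y / 2 >= t * eta * (3 / 8 * gn ^+ 2).
  move=> /andP [t0 t1].
  have t2 : t ^+ 2 * y <= t * y by rewrite expr2 -mulrA ler_piMl // mulr_ge0 // ltW.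
  have : t * eta * (3 / 8 * gn ^+ 2) <= t * eta * (ip g D - frobenius D ^+ 2 / 2).
    by rewrite ler_wpM2l ?mulr_ge0 ?(ltW t0) ?(ltW eta0) // gD DD; lra.
  rewrite /y in t2 *; lra.
have fle1 : f 1 <= h.
  rewrite leNgt; apply/negP => f1.
  (* A point of the segment so close to [K] that the remainder cannot outweigh
     the linear term: [u <= 1] and [u ^+ 2 * y <= h]. *)
  pose u := h / (y + h).
  have u0 : 0 < u by rewrite divr_gt0 // ltr_wpDl.
  have u1 : u <= 1 by rewrite ler_pdivrMr ?mul1r ?lerDr // ltr_wpDl.
  have u01 : 0 <= u <= 1 by rewrite (ltW u0).
  have uy : u ^+ 2 * y <= h.
    apply: (@le_trans _ _ (u * y)).
      by rewrite expr2 -mulrA ler_piMl // mulr_ge0 // ltW.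
    have yh : 0 < y + h by rewrite ltr_wpDl.
    rewrite /u mulrAC ler_pdivrMr // ler_wpM2l ?(ltW h0) //.
    by rewrite lerDl (ltW h0).
  have fu : f u <= h.
    rewrite leNgt; apply/negP => fu.
    have e1 := est u u01; have e2 := drop u; rewrite u0 u1 in e2; have {}e2 := e2 isT.
    have e3 : 0 < u * eta * (3 / 8 * gn ^+ 2) by rewrite mulr_gt0 // mulr_gt0.
    have e4 : f u / h * (u ^+ 2 * y / 2) = u ^+ 2 * y / 2 + (f u - h) * (u ^+ 2 * y / h / 2).
      by field; rewrite gt_eqF.
    have e5 : (f u - h) * (u ^+ 2 * y / h / 2) <= (f u - h) * 1.
      rewrite ler_wpM2l ?subr_ge0 ?(ltW fu) // ler_pdivrMr // ler_pdivrMr //; lra.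
    lra.
  have fmm : Num.min (f u) (f 1) <= h <= Num.max (f u) (f 1).
    by rewrite ge_min fu le_max (ltW f1) orbT.
  have [t] := IVT u1 (segment_continuous Gt (ltW u0)) fmm.
  rewrite in_itv /= => /andP [ut t1]; rewrite -/(f t) => ft.
  have t0 : 0 < t by exact: lt_le_trans ut.
  have := est t; rewrite (ltW t0) t1 ft => /(_ isT).
  have := drop t; rewrite t0 t1 => /(_ isT).
  have e3 : 0 < t * eta * (3 / 8 * gn ^+ 2) by rewrite mulr_gt0 // mulr_gt0.
  by rewrite divff ?gt_eqF //; lra.
have f1E : f 1 = J (K + E) by rewrite /f scale1r.
split; first by have := Gt 1; rewrite scale1r; apply; rewrite ler01 lexx.
have := est 1; rewrite ler01 lexx => /(_ isT).
have := drop 1; rewrite ltr01 lexx => /(_ isT).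
have : f 1 / h * (1 ^+ 2 * y / 2) <= 1 * (1 ^+ 2 * y / 2).
  by rewrite ler_wpM2r ?ler_pdivrMr ?mul1r // expr1n mul1r divr_ge0.
rewrite f1E; lra.
Qed.

(** * The optimal gain *)

Lemma R_unit : R \in unitmx.
Proof.
have /sym_posdefE [_ R0] := posR.
rewrite -unitmx_tr -row_free_unit; apply: inj_row_free => v vR.
apply/eqP; rewrite -trmx_eq0; apply/negP => /negP v0.
have := R0 _ v0; rewrite -[R]trmxK -trmx_mul vR trmx0 ip0r ltxx //.
Qed.

Lemma posform_form_mx p k (Z : 'M[F]_p) (X : 'M[F]_(p, k)) c :
  (forall x : 'cV[F]_p, c * ip x x <= ip x (Z *m x)) ->
  c * ip X X <= ip X (Z *m X).
Proof.
move=> Zc; rewrite (ip_col X X) (ip_col X (Z *m X)) mulr_sumr.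
by apply: ler_sum => j _; rewrite !colE -!mulmxA; exact: Zc.
Qed.

(** With the descent lemma a minimizer of the cost has vanishing gradient;
    since the correlation matrix is invertible the residual vanishes too. *)
Lemma minimizer_residual K : G K -> (forall K', G K' -> J K <= J K') -> M K = 0.
Proof.
move=> GK Kmin; have h0 := lqr_J_gt0 GK.
have L0 : 0 < lqr_L A B Q R (J K).
  rewrite (lqr_LE (ltW h0)) !mulr_gt0 //.
  by apply: lt_le_trans (curvature_lower (ltW h0)); rewrite divr_gt0 ?spectral_norm_R_gt0 ?lambda_min_Q_gt0.
have eta0 : 0 < (lqr_L A B Q R (J K))^-1 by rewrite invr_gt0.
have etaL : (lqr_L A B Q R (J K))^-1 * lqr_L A B Q R (J K) <= 1 by rewrite mulVf ?gt_eqF.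
have W0 : 2 * frobenius (0 : 'M[F]_(m, n)) <= frobenius (lqr_grad A B Q R K).
  by rewrite fro0 mulr0 fro_ge0.
have [GK' JK'] := perturbed_descent GK eta0 etaL W0.
have := Kmin _ GK'; set g := lqr_grad A B Q R K in JK' *; set eta := _^-1 in eta0 JK' *.
move=> JK.
have g0 : g = 0.
  apply/eqP; rewrite -fro_eq0 -sqrf_eq0 eq_le sqr_ge0 andbT.
  have c0 : 0 < 3 / 8 * eta by rewrite mulr_gt0 // divr_gt0.
  by rewrite -(ler_pM2l c0) mulr0; move: (le_trans JK JK'); clear; lra.
have MY0 : M K *m Y K = 0.
  by apply/eqP; move/eqP: g0; rewrite /g /lqr_grad scaler_eq0 pnatr_eq0.
have [y0 y0p Yl] := posform_lower (lqr_Y_sym GK) (lqr_Y_pos GK).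
have := posform_form_mx (M K)^T Yl.
rewrite -(lqr_Y_sym GK) -trmx_mul MY0 trmx0 ip0r pmulr_rle0 // => H.
by apply/eqP; rewrite -trmx_eq0 -ip_eq0 eq_le H ip_ge0.
Qed.

Definition riccati (X : 'M[F]_n) :=
  A^T *m X + X *m A + Q - X *m B *m invmx R *m B^T *m X = 0.

(** With the gain that [X] induces, the Riccati equation is the Lyapunov equation
    for the closed loop with the stage cost. *)
Lemma riccati_lyap (X : 'M[F]_n) (K := invmx R *m B^T *m X) : X^T = X ->
  riccati X <-> lyap (cl K) X = - stage_cost K.
Proof.
move=> sX; have Ru := R_unit.
have KT : K^T = X *m B *m invmx R by rewrite /K !trmx_mul trmxK trmx_inv R_sym sX mulmxA.
have -> : stage_cost K = Q + X *m B *m invmx R *m B^T *m X.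
  by rewrite /stage_cost KT mulmxKV // /K !mulmxA.
have clT : (cl K)^T = A^T - X *m B *m invmx R *m B^T.
  by rewrite /closed_loop linearB /= trmx_mul KT.
have -> : lyap (cl K) X = A^T *m X + X *m A
    - X *m B *m invmx R *m B^T *m X - X *m B *m invmx R *m B^T *m X.
  by rewrite /lyap clT mulmxBl /closed_loop mulmxBr /K !mulmxA addrACA !addrA.
rewrite /riccati; move: (A^T *m X + X *m A) (_ *m X) => t1 t2.
split => [H|/eqP]; last first.
  rewrite -subr_eq0 => /eqP <-; apply/matrixP => i j; rewrite !mxE; ring.
apply/eqP; rewrite -subr_eq0 -H; apply/eqP/matrixP => i j; rewrite !mxE; ring.
Qed.

Lemma riccati_exists : stabilizable A B ->
  exists X, sym_posdef X /\ riccati X.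
Proof.
move=> /J_min [K GK Kmin]; have MK := minimizer_residual GK Kmin.
exists (P K); split; first by apply/sym_posdefE; split; [exact: lqr_P_sym|exact: lqr_P_pos].
have KE : invmx R *m B^T *m P K = K.
  move/eqP: MK; rewrite subr_eq0 => /eqP RK.
  by rewrite -mulmxA -RK mulKmx // R_unit.
by apply/riccati_lyap; rewrite ?KE; [exact: lqr_P_sym|exact: lqr_P_eq].
Qed.

Local Notation Ks := (lqr_opt_gain A B Q R).

(** Any positive definite solution of the Riccati equation is a certificate for
    the gain it induces, hence the one selected in [Ks] is [P Ks]. *)
Lemma opt_gain_props : stabilizable A B -> G Ks /\ M Ks = 0.
Proof.
move=> stab; have [X0 X0P] := riccati_exists stab.
have : [set X | sym_posdef X /\ riccati X] (riccati_sol A B Q R).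
  by apply: (@xgetPex _ 0 [set X | sym_posdef X /\ riccati X]); exists X0.
move=> /= []; set X := riccati_sol A B Q R => /sym_posdefE [sX pX] /(riccati_lyap sX).
rewrite -[invmx R *m B^T *m X]/Ks => XK.
have GKs : G Ks.
  apply: (@certificate_hurwitz _ _ _ X); split => // x x0.
  have E1 : ip x (X *m cl Ks *m x) = ip (X *m x) (cl Ks *m x) by rewrite [RHS]ipMl sX mulmxA.
  have := lyap_form (cl Ks) x sX; rewrite XK mulNmx ipNr -E1.
  by have := stage_cost_pos Ks x0; rewrite -/(cl Ks); lra.
split => //; have -> : M Ks = R *m Ks - B^T *m X.
  by congr (_ - _ *m _); apply: (lyap_sol_uniq GKs).
by rewrite /lqr_opt_gain -mulmxA mulKVmx ?R_unit // subrr.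
Qed.

(** Around the optimal gain the linear term of the cost difference vanishes, so
    the cost gap is a positive quadratic form weighted by the correlation
    matrix. *)
Lemma J_gap K : G K -> G Ks -> M Ks = 0 ->
  J K - J Ks = ip ((K - Ks)^T *m R *m (K - Ks)) (Y K).
Proof.
move=> GK GKs MKs; have EK : Ks + (K - Ks) = K by rewrite addrC subrK.
have := @lqr_J_diff Ks (K - Ks) GKs; rewrite EK => /(_ GK) ->.
by rewrite /residual_form MKs trmx0 mul0mx mulmx0 addr0 ip0l add0r.
Qed.

(** Both weights can be replaced by multiples of the identity, one after the
    other, because pairing with a nonnegative form is monotone. *)
Lemma quad_cost_lower K E y0 : G K -> (forall x : 'cV[F]_n, y0 * ip x x <= ip x (Y K *m x)) ->
  rho * (y0 * frobenius E ^+ 2) <= ip (E^T *m R *m E) (Y K).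
Proof.
move=> GK Yl; apply: (@le_trans _ _ (rho * ip (E^T *m E) (Y K))).
  rewrite ler_wpM2l ?(ltW lambda_min_R_gt0) //.
  have -> : ip (E^T *m E) (Y K) = ip E^T (Y K *m E^T).
    by rewrite ipMr.
  by rewrite -fro_tr fro_sq posform_form_mx.
rewrite -ipZl; apply: ip_Y_monotone => //.
- by rewrite linearZ /= trmx_mul trmxK.
- exact: quad_cost_sym.
- by move=> x; rewrite quad_costE -scalemxAl ipZr -mulmxA -ipMl R_lower.
Qed.

Lemma J_gap_pos K : G K -> G Ks -> M Ks = 0 -> K != Ks -> 0 < J K - J Ks.
Proof.
move=> GK GKs MKs KKs; rewrite J_gap //.
have [y0 y0p Yl] := posform_lower (lqr_Y_sym GK) (lqr_Y_pos GK).
apply: lt_le_trans (quad_cost_lower (K - Ks) GK Yl).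
by rewrite !mulr_gt0 ?lambda_min_R_gt0 ?exprn_gt0 ?fro_gt0 // subr_eq0.
Qed.

Lemma J_gap_ge0 K : G K -> G Ks -> M Ks = 0 -> 0 <= J K - J Ks.
Proof.
move=> GK GKs MKs; have [->|KKs] := eqVneq K Ks; first by rewrite subrr.
exact/ltW/J_gap_pos.
Qed.

(** * Gradient domination *)

(** At a unit eigenvector [y] for the smallest eigenvalue [mu] of [Y K], the
    Lyapunov equation reads [- 1 = 2 * mu * <y, cl^T *m y>]. *)
Lemma Y_lower K k (x : 'cV[F]_n) : G K -> frobenius (cl K) <= k -> 0 < k ->
  (2 * k)^-1 * ip x x <= ip x (Y K *m x).
Proof.
move=> GK clk k0.
have [mu [y [y_0 Yy muY]]] := rayleigh n_gt0 (lqr_Y_sym GK) (@trmx1 _ _) (@posform1 F n).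
rewrite mul1mx in Yy; apply: le_trans (_ : mu * ip x x <= _); last first.
  by have := muY x; rewrite mul1mx.
rewrite ler_wpM2r ?ip_ge0 //.
have yy := ip_gt0 y_0.
have mu0 : 0 < mu.
  by have := lqr_Y_pos GK y_0; rewrite Yy ipZr pmulr_lgt0.
have := lyap_form (cl K)^T y (lqr_Y_sym GK).
rewrite (lqr_Y_eq GK) mulNmx mul1mx ipNr Yy ipZl => H.
have H1 := ip_CSN y ((cl K)^T *m y).
have H2 : frobenius y * frobenius ((cl K)^T *m y) <= k * ip y y.
  rewrite -fro_sq expr2 mulrCA ler_wpM2l ?fro_ge0 //.
  by apply: le_trans (fro_op _ _) _; rewrite fro_tr ler_wpM2r ?fro_ge0.
have H3 : mu * (frobenius y * frobenius ((cl K)^T *m y)) <= mu * (k * ip y y).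
  by rewrite ler_wpM2l // ltW.
have H4 : mu * - (frobenius y * frobenius ((cl K)^T *m y)) <= mu * ip y ((cl K)^T *m y).
  by rewrite ler_wpM2l // ltW.
rewrite -[X in X <= _]mul1r ler_pdivrMr ?mulr_gt0 // -(ler_pM2r yy) mul1r; lra.
Qed.

(** The gradient is [2 *: (M K *m Y K)] and [Y K] is at least [(2 * k)^-1]. *)
Lemma grad_lower K k : G K -> frobenius (cl K) <= k -> 0 < k ->
  frobenius (M K) <= k * frobenius (lqr_grad A B Q R K).
Proof.
move=> GK clk k0; rewrite /lqr_grad froZ ger0_norm //.
have Yl := posform_form_mx (M K)^T (fun x => Y_lower x GK clk k0).
have := ip_CS (M K)^T (Y K *m (M K)^T).
have [M0|M0] := eqVneq (M K) 0.
  by rewrite M0 fro0 mulr_ge0 ?(ltW k0) // mulr_ge0 ?fro_ge0.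
rewrite fro_tr -[X in frobenius (X *m _)](lqr_Y_sym GK) -trmx_mul fro_tr => H.
have Mp := fro_gt0 M0.
move: (le_trans Yl H); rewrite -fro_sq fro_tr expr2 mulrCA ler_pM2l //.
by rewrite mulrC ler_pdivrMr ?mulr_gt0 //; lra.
Qed.

(** Gradient domination with saturation. The residual dominates both the square
    root of the cost gap and the distance to the optimal gain; the gradient is
    the residual times the correlation matrix, whose smallest eigenvalue decays
    no faster than the inverse of that distance. *)
Lemma gradient_domination : G Ks -> M Ks = 0 ->
  exists p1 p2 : F, [/\ 0 < p1, 0 < p2 & forall K, G K ->
    p1 * (J K - J Ks) <= frobenius (lqr_grad A B Q R K) ^+ 2 \/
    p2 <= frobenius (lqr_grad A B Q R K)].
Proof.
move=> GKs MKs; have rp := lambda_min_R_gt0.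
have [y0 y0p Yl] := posform_lower (lqr_Y_sym GKs) (lqr_Y_pos GKs).
set Ys := Y Ks in Yl.
have b0 := spectral_norm_ge0 B.
have tr0 : 0 < \tr Ys + 1 by rewrite ltr_wpDl // trace_nn //; exact: lqr_Y_nn.
have fY0 : 0 < frobenius Ys + 1 by rewrite ltr_wpDl // fro_ge0.
(* [k * max 1 |E|] bounds the closed loop matrix at [Ks - E], and [c * |E|] will
   bound the residual from below. *)
pose k := frobenius (cl Ks) + b + 1.
have k0 : 0 < k by rewrite ltr_wpDl // addr_ge0 ?fro_ge0.
pose c := rho * y0 / (2 * (frobenius Ys + 1)).
have c0 : 0 < c by rewrite divr_gt0 ?mulr_gt0.
exists (rho / (\tr Ys + 1) / k ^+ 2), (c / k); split.
- by rewrite !divr_gt0 ?exprn_gt0.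
- by rewrite divr_gt0.
move=> K GK; have V0 := J_gap_ge0 GK GKs MKs.
pose E := Ks - K; have EK : K + E = Ks by rewrite addrC subrK.
have diff : J Ks - J K = ip (residual_form K E) Ys + ip (E^T *m R *m E) Ys.
  by have := @lqr_J_diff K E GK; rewrite EK => ->.
have cle : frobenius (cl K) <= frobenius (cl Ks) + b * frobenius E.
  have -> : cl K = cl Ks + B *m E.
    by rewrite /closed_loop /E mulmxBr addrA subrK.
  apply: le_trans (froD _ _) _; rewrite lerD2l.
  by apply: fro_mul_op => // x; exact: spectral_norm_op.
have fE := fro_ge0 E; have fM := fro_ge0 (M K); have fg := fro_ge0 (lqr_grad A B Q R K).
have V_M : rho / (\tr Ys + 1) * (J K - J Ks) <= frobenius (M K) ^+ 2.
  rewrite mulrAC ler_pdivrMr //.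
  apply: (@le_trans _ _ (ip ((frobenius (M K) ^+ 2) *: 1%:M) Ys)); last first.
    by rewrite ipZl ipC ip1r ler_wpM2l ?sqr_ge0 // lerDl.
  have -> : rho * (J K - J Ks) = ip (- (rho *: (residual_form K E + E^T *m R *m E))) Ys.
    by rewrite ipNl ipZl ipDl -diff; ring.
  apply: ip_Y_monotone => //.
  - by rewrite linearN linearZ linearD /= residual_form_sym quad_cost_sym.
  - by rewrite linearZ /= trmx1.
  move=> x; rewrite mulNmx -!scalemxAl ipNr !ipZr mulmxDl ipDr mul1mx.
  rewrite residual_formE quad_costE.
  have H1 := R_lower (E *m x); have H2 := ip_ge0 (rho *: (E *m x) + M K *m x).
  rewrite !ip_lin (ipC (M K *m x)) in H2.
  have H3 : ip (M K *m x) (M K *m x) <= frobenius (M K) ^+ 2 * ip x x.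
    by rewrite -!fro_sq -exprMn lerXn2r ?nnegrE ?mulr_ge0 ?fro_ge0 ?fro_op.
  have H4 : rho * (rho * ip (E *m x) (E *m x)) <= rho * ip (E *m x) (R *m (E *m x)).
    by rewrite ler_wpM2l // ltW.
  lra.
have E_M : c * frobenius E <= frobenius (M K).
  have H1 := quad_cost_lower E GKs Yl.
  have H2 : - ip (residual_form K E) Ys <= 2 * (frobenius (M K) * (frobenius Ys + 1) * frobenius E).
    rewrite ip_residual_form ?lqr_Y_sym // -mulrN ler_wpM2l // -ipNr.
    apply: le_trans (ip_CS _ _) _; rewrite froN ler_wpM2r //.
    by apply: le_trans (fro_mul _ _) _; rewrite ler_wpM2l // lerDl.
  have [E0|E0] := eqVneq E 0; first by rewrite E0 fro0 mulr0.
  have Ep := fro_gt0 E0.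
  rewrite /c mulrAC ler_pdivrMr ?mulr_gt0 // -(ler_pM2r Ep).
  rewrite expr2 in H1; move: H1 H2 diff V0; rewrite -/Ys; clear; lra.
(* Near the optimal gain the closed loop matrix is bounded and the gap controls
   the residual; far away it grows like [E], but so does the residual. *)
have [E1|/ltW E1] := leP (frobenius E) 1; [left|right].
  have clk : frobenius (cl K) <= k.
    by apply: le_trans cle _; rewrite /k -addrA lerD2l; have := ler_piMr b0 E1; lra.
  rewrite mulrAC ler_pdivrMr ?exprn_gt0 //; apply: le_trans V_M _.
  have := grad_lower GK clk k0.
  by rewrite [leRHS]mulrC -exprMn => H; rewrite lerXn2r ?nnegrE // mulr_ge0 // ltW.
have E0 : 0 < frobenius E by lra.
have clk : frobenius (cl K) <= k * frobenius E.
  apply: le_trans cle _; rewrite /k !mulrDl mul1r.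
  have := ler_peMr (fro_ge0 (cl Ks)) E1; lra.
rewrite ler_pdivrMr //; have kE : 0 < k * frobenius E by rewrite mulr_gt0.
have := grad_lower GK clk kE => H.
rewrite -(ler_pM2r E0); move: (le_trans E_M H); clear; lra.
Qed.
(** * One step of the perturbed iteration *)

Local Ltac slra := clear - A B n_gt0 m_gt0 posQ posR; lra.

(** If the gradient dominates the
    perturbation, the descent estimate and gradient domination apply. Otherwise
    gradient domination places the gain near the optimum, and the remainder
    estimate bounds the cost gap after the step by a multiple of [w ^+ 2]. *)
Lemma perturbed_step : G Ks -> M Ks = 0 ->
  exists p1 p2 d C : F, [/\ 0 < p1, 0 < p2, 0 < d, 0 < C &
  forall K W eta w, G K -> 0 < eta -> eta * lqr_L A B Q R (J K) <= 1 ->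
    frobenius W <= w -> w < d ->
    let K' := K - eta *: (lqr_grad A B Q R K + W) in
    G K' /\ (J K' - J Ks <= C * w ^+ 2 \/
      J K' - J Ks <= J K - J Ks - eta * Num.min (p1 * (J K - J Ks)) p2)].
Proof.
move=> GKs MKs; have [p1 [p2 [p1_0 p2_0 PL]]] := gradient_domination GKs MKs.
have J0 := lqr_J_gt0 GKs; set Js := J Ks in J0 PL *.
have qp := lambda_min_Q_gt0; have rp := spectral_norm_R_gt0; have b0 := spectral_norm_ge0 B.
(* [L0] bounds [lqr_L] from below, so [eta <= L0^-1]; [hm] bounds the cost of a
   gain whose gradient is below [2 * w]. For a step taken at such a gain, [be * w]
   bounds the quantity that [stable_ball] compares with [q], and [de * w ^+ 2] is
   the coefficient of the new cost in the remainder. *)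
pose L0 := 2 * Js * (r / q).
have L00 : 0 < L0 by rewrite !mulr_gt0 // invr_gt0.
pose hm := Js + 4 / p1.
have hm0 : 0 < hm by rewrite addr_gt0 // divr_gt0.
pose de := 9 / (2 * Js * L0).
have de0 : 0 < de by rewrite divr_gt0 // mulr_gt0 // mulr_gt0.
pose be := 6 * hm * b / L0.
have be0 : 0 <= be by rewrite divr_ge0 ?(ltW L00) // mulr_ge0 // mulr_ge0 // ltW.
pose C := 4 / p1 + L0^-1 + 2 * de * (hm + L0^-1).
have C0 : 0 < C.
  have i0 : 0 < L0^-1 by rewrite invr_gt0.
  have i1 : 0 < 4 / p1 by rewrite divr_gt0.
  have i2 : 0 < 2 * de * (hm + L0^-1) by apply: mulr_gt0; [exact: mulr_gt0|exact: addr_gt0].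
  by move: i0 i1 i2; rewrite /C; slra.
pose d := Num.min (Num.min 1 (p2 / 2)) (Num.min (q / (be + 1)) (2 * (de + 1))^-1).
exists (3 / 8 * p1), (3 / 8 * p2 ^+ 2), d, C; split.
- by rewrite mulr_gt0 // divr_gt0.
- by rewrite mulr_gt0 ?exprn_gt0 // divr_gt0.
- have be1 : 0 < be + 1 by move: be0; slra.
  have de1 : 0 < 2 * (de + 1) by move: de0; slra.
  rewrite !lt_min ltr01 invr_gt0 de1 andbT /=.
  by apply/andP; split; exact: divr_gt0.
- exact: C0.
move=> K W eta w GK eta0 etaL Ww; rewrite !lt_min => /andP [/andP [w1 w2] /andP [w3 w4]].
have V0 := J_gap_ge0 GK GKs MKs; rewrite -/Js in V0.
have h0 := lqr_J_gt0 GK.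
have W0 := fro_ge0 W; have w0 : 0 <= w by exact: le_trans Ww.
set g := lqr_grad A B Q R K; have g0 := fro_ge0 g.
have [gw|gw] := leP (2 * w) (frobenius g).
  have Wg : 2 * frobenius W <= frobenius g by apply: le_trans gw; rewrite ler_wpM2l.
  have [GK' JK'] := perturbed_descent GK eta0 etaL Wg; rewrite -/g in JK'.
  split => //; right.
  have -> : Num.min (3 / 8 * p1 * (J K - Js)) (3 / 8 * p2 ^+ 2) =
      3 / 8 * Num.min (p1 * (J K - Js)) (p2 ^+ 2).
    by rewrite minr_pMr ?mulrA // divr_ge0.
  have mg : Num.min (p1 * (J K - Js)) (p2 ^+ 2) <= frobenius g ^+ 2.
    case: (PL K GK); rewrite -/g => H; rewrite ge_min ?H //.
    by apply/orP; right; rewrite lerXn2r ?nnegrE // ltW.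
  have : eta * (3 / 8 * Num.min (p1 * (J K - Js)) (p2 ^+ 2)) <=
      eta * (3 / 8 * frobenius g ^+ 2).
    by apply: ler_wpM2l; [exact: ltW|apply: ler_wpM2l; rewrite // divr_ge0].
  by move: JK'; slra.
have V4 : J K - Js <= 4 / p1 * w ^+ 2.
  have [H|H] := PL K GK; rewrite -/g in H.
    rewrite mulrAC ler_pdivlMr // mulrC; apply: le_trans H _.
    have : frobenius g * frobenius g <= (2 * w) * (2 * w) by apply: ler_pM => //; exact: ltW.
    by rewrite !expr2; slra.
  by exfalso; move: H gw w2; slra.
have ww : w ^+ 2 <= w by rewrite expr2 ler_piMl // ltW.
have w21 : w ^+ 2 <= 1 by exact: le_trans ww (ltW w1).
have w20 : 0 <= w ^+ 2 by exact: sqr_ge0.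
have hhm : J K <= hm.
  have : 4 / p1 * w ^+ 2 <= 4 / p1 by rewrite ler_piMr // divr_ge0 // ltW.
  by move: V4; rewrite /hm; slra.
have hJs : Js <= J K by move: V0; slra.
have LE := lqr_LE (ltW h0).
have L_lower : L0 <= lqr_L A B Q R (J K).
  rewrite LE /L0; apply: ler_pM; rewrite ?curvature_lower ?(ltW h0) //.
  - by rewrite mulr_ge0 // ltW.
  - by rewrite divr_ge0 // ltW.
  - by rewrite ler_wpM2l.
have etaL0 : eta <= L0^-1.
  rewrite -[leRHS]mul1r ler_pdivlMr //; apply: le_trans etaL.
  by rewrite ler_wpM2l // ltW.
rewrite LE in etaL; set c := curvature (J K) in etaL.
have c0 : 0 <= c by apply: curvature_ge0; exact: ltW.
have ceta : eta * c <= (2 * Js)^-1.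
  rewrite -[leRHS]mul1r ler_pdivlMr ?mulr_gt0 //; apply: le_trans etaL.
  have : (eta * c) * (2 * Js) <= (eta * c) * (2 * J K).
    by rewrite ler_wpM2l ?mulr_ge0 ?(ltW eta0) // ler_wpM2l.
  by slra.
pose D := g + W; pose E := - (eta *: D); rewrite /= -/E.
have D3 : frobenius D <= 3 * w.
  by apply: le_trans (froD _ _) _; move: Ww gw; slra.
have D0 := fro_ge0 D.
have En : frobenius E = eta * frobenius D by rewrite /E froN froZ gtr0_norm.
have E3 : frobenius E <= L0^-1 * (3 * w).
  by rewrite En ler_pM // ltW.
have GK' : G (K + E).
  apply: stable_ball => //.
  apply: (@le_lt_trans _ _ (2 * hm * b * (L0^-1 * (3 * w)))).
    by apply: ler_pM; rewrite ?fro_ge0 ?mulr_ge0 ?(ltW h0) // ler_wpM2r // ler_wpM2l.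
  have -> : 2 * hm * b * (L0^-1 * (3 * w)) = be * w by rewrite /be; ring.
  have be1 : 0 < be + 1 by move: be0; slra.
  by move: w3; rewrite ltr_pdivlMr //; move: w0; slra.
split => //; left.
have h'0 := ltW (lqr_J_gt0 GK'); set h' := J (K + E) in h'0 *.
have := J_remainder GK GK'; rewrite -/h' -/c -/g ler_norml => /andP [_ rem].
have gD : ip g E <= L0^-1 * w ^+ 2.
  have -> : ip g E = eta * (- frobenius g ^+ 2 - ip g W).
    by rewrite /E ipNr ipZr /D ipDr -fro_sq; ring.
  apply: (@le_trans _ _ (eta * w ^+ 2)); last by rewrite ler_wpM2r.
  rewrite ler_wpM2l ?(ltW eta0) //.
  have := ip_CSN g W; have : frobenius g * frobenius W <= frobenius g * w by rewrite ler_wpM2l.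
  have := sqr_ge0 (frobenius g - w); have := sqr_ge0 (frobenius g).
  by rewrite sqrrB; move: w20; slra.
have cE : c * frobenius E ^+ 2 <= de * w ^+ 2.
  have -> : c * frobenius E ^+ 2 = (eta * c) * (eta * frobenius D ^+ 2).
    by rewrite En; ring.
  have -> : de * w ^+ 2 = (2 * Js)^-1 * (L0^-1 * (3 * w) ^+ 2).
    by rewrite /de invfM; ring.
  apply: ler_pM => //; first by rewrite mulr_ge0 // ltW.
    by rewrite mulr_ge0 ?sqr_ge0 // ltW.
  apply: ler_pM => //; rewrite ?(ltW eta0) ?sqr_ge0 //.
  by rewrite lerXn2r ?nnegrE // mulr_ge0.
have cEh : c * h' * frobenius E ^+ 2 <= de * w ^+ 2 * h'.
  by rewrite mulrAC ler_wpM2r.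
have dew : de * w <= 2^-1.
  have de1 : 0 < de + 1 by move: de0; slra.
  move: w4; rewrite invfM -[ltRHS]/(2^-1 / (de + 1)) ltr_pdivlMr //.
  by move: w0; slra.
have dewh : de * w ^+ 2 * h' <= 2^-1 * h'.
  rewrite ler_wpM2r //; apply: le_trans dew; rewrite ler_wpM2l // ltW //.
have h'le : h' <= 2 * (hm + L0^-1).
  have : L0^-1 * w ^+ 2 <= L0^-1 by rewrite ler_piMr // invr_ge0 ltW.
  by move: rem gD cEh dewh hhm; slra.
have : de * w ^+ 2 * h' <= de * w ^+ 2 * (2 * (hm + L0^-1)).
  by rewrite ler_wpM2l // mulr_ge0 // ltW.
have CE : C * w ^+ 2 = 4 / p1 * w ^+ 2 + L0^-1 * w ^+ 2 + de * w ^+ 2 * (2 * (hm + L0^-1)).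
  by rewrite /C; ring.
by move: rem gD cEh V4; rewrite CE; slra.
Qed.

(** On a sublevel set the gains are bounded, and they keep a fixed distance from
    the boundary because a whole ball around each of them is stabilizing. *)
Lemma J_coercive (Kseq : nat -> 'M[F]_(m, n)) : (forall k, G (Kseq k)) ->
  tends_to_set Kseq (boundary G) \/ frobenius (Kseq k) @[k --> \oo] --> +oo ->
  forall h, 0 <= h -> \forall k \near \oo, h < J (Kseq k).
Proof.
move=> GK lim h h0; case: lim => [bd|nrm].
  have := bd _ (stable_radius_gt0 h0); apply: filterS => k [X [_ nX] KX].
  rewrite ltNge; apply/negP => Jh; apply: nX.
  apply/nbhs_froP; exists (stable_radius h - frobenius (Kseq k - X)).
    by rewrite subr_gt0.
  move=> Z ZX; apply: (sublevel_ball (GK k) Jh).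
  have -> : Z - Kseq k = (Z - X) - (Kseq k - X) by rewrite opprB addrA subrK.
  by apply: le_lt_trans (froB _ _) _; move: ZX; slra.
have /cvgryPgt/(_ (gain_bound h * frobenius (1%:M : 'M[F]_n))) := nrm.
apply: filterS => k; rewrite !ltNge; apply: contra => Jh.
exact: sublevel_bounded.
Qed.

End LQRCost.

(** * A KL function from countably many decay rates *)

Section Comparison.
Variable F : realType.

Lemma cvg_sum_ord0 (T : Type) (D : set_system T) (FD : Filter D) L (u : nat -> T -> F) :
  (forall N, u N x @[x --> D] --> 0) -> \sum_(N < L) u N x @[x --> D] --> 0.
Proof.
move=> u0; elim: L => [|L IH].
  by under eq_fun do rewrite big_ord0; exact: cvg_cst.
under eq_fun do rewrite big_ord_recr /=.
by have H := cvgD IH (u0 L); rewrite addr0 in H; exact: H.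
Qed.

Section Majorant.
Variable s : nat -> nat -> F.
Hypothesis s_ge0 : forall N k, 0 <= s N k.
Hypothesis s_homo : forall N k l, (k <= l)%N -> s N k <= s N l.
Hypothesis s_large : forall N T, exists k0, forall k, (k0 <= k)%N -> T <= s N k.

(** A continuous function that dominates [r] from [N] to [N.+1] and vanishes up to
    [N.-1], so that only finitely many of them are active on a bounded range. *)
Definition bump_weight (N : nat) (r : F) : F := N.+1%:R * Num.max 0 (r - N.-1%:R).

Definition decay (N : nat) (t : F) : F := (1 + s N (Num.truncn t))^-1.

(** A continuous gluing of the decay rates [1 / (1 + s N k)], the [N]-th of which
    is needed for initial values in the [N]-th unit interval; the first term
    makes it strictly increasing. *)
Definition glued (r t : F) : F :=
  r / (1 + t) + \sum_(N < (Num.truncn r).+2) bump_weight N r * decay N t.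

Lemma decay_gt0 N t : 0 < decay N t.
Proof. by rewrite invr_gt0 ltr_wpDr. Qed.

Lemma bump_weight_ge0 N r : 0 <= bump_weight N r.
Proof. by rewrite mulr_ge0 // le_max lexx. Qed.

Lemma bump_weight0 N r : r <= N.-1%:R -> bump_weight N r = 0.
Proof. by move=> rN; rewrite /bump_weight max_l ?mulr0 // subr_le0. Qed.

Lemma bump_weight_homo N r r' : r <= r' -> bump_weight N r <= bump_weight N r'.
Proof.
move=> rr'; rewrite ler_wpM2l // ge_max !le_max lexx /=.
by rewrite lerD2r rr' orbT.
Qed.

Lemma gluedE L r t : (Num.truncn r + 2 <= L)%N ->
  glued r t = r / (1 + t) + \sum_(N < L) bump_weight N r * decay N t.
Proof.
move=> rL; rewrite /glued; congr (_ + _); rewrite -addn2.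
rewrite -!(big_mkord xpredT (fun N => bump_weight N r * decay N t)).
rewrite [RHS](big_cat_nat _ (n := (Num.truncn r + 2)%N)) //=.
rewrite [X in _ + X]big_nat_cond [X in _ + X]big1 ?addr0 // => N.
rewrite andbT => /andP [rN _]; rewrite bump_weight0 ?mul0r //.
apply/ltW/(lt_le_trans (truncnS_gt r)); rewrite ler_nat.
by rewrite -ltnS; move: rN; rewrite addn2; case: N.
Qed.

Lemma glued_continuous t : continuous (glued ^~ t).
Proof.
move=> r0; pose L := (Num.truncn (`|r0| + 1) + 2)%N.
pose g := (fun r => r / (1 + t)) \+ (fun r => \sum_(N < L) bump_weight N r * decay N t).
have gc : continuous g.
  have bc N : continuous (bump_weight N).
    have -> : bump_weight N =
      (fun=> N.+1%:R) \* ((fun=> 0) \max (id - (fun=> N.-1%:R : F))) by [].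
    move=> r; apply: continuousM; first exact: cst_continuous.
    apply: continuous_max; first exact: cst_continuous.
    by apply: continuousB; [exact: cvg_id|exact: cst_continuous].
  move=> r; apply: continuousD.
    apply: (@continuousM _ _ id (fun=> (1 + t)^-1)); first exact: cvg_id.
    exact: cst_continuous.
  apply: (@continuous_sumr _ _ _ _ (fun (N : 'I_L) r => bump_weight N r * decay N t)) => N x.
  apply: (@continuousM _ _ (bump_weight N) (fun=> decay N t)); first exact: bc.
  exact: cst_continuous.
have eqg : \forall r \near r0, g r = glued r t.
  apply/nbhs_normP; exists 1 => //= r rr0; rewrite (@gluedE L) // leq_add2r.
  apply: le_truncn; apply: le_trans (ler_norm _) _.
  have rr1 : `|r0 - r| < 1 := rr0.
  have := ler_normD (r - r0) r0; rewrite subrK (distrC r); lra.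
rewrite /prop_for /continuous_at -(nbhs_singleton eqg).
by apply: cvg_trans (gc r0); exact: near_eq_cvg.
Qed.

Lemma glued_classKL : classKL glued.
Proof.
split=> [t t0|r r0].
  split.
  - by apply: continuous_subspaceT; exact: glued_continuous.
  - move=> r r' [r0 _] [r'0 _] rr'.
    rewrite (@gluedE ((Num.truncn r').+2) r); last by rewrite addn2 !ltnS le_truncn // ltW.
    apply: ltr_leD; first by rewrite ltr_pM2r // invr_gt0 ltr_wpDr.
    apply: ler_sum => N _; rewrite ler_wpM2r ?(ltW (decay_gt0 _ _)) //.
    by rewrite bump_weight_homo // ltW.
  - by rewrite /glued mul0r add0r big1 // => N _; rewrite bump_weight0 ?mul0r.
split=> [u v u0 uv|].
  have v0 := le_trans u0 uv.
  apply: lerD; first by rewrite ler_wpM2l // lef_pV2 ?posrE ?lerD2l // ltr_wpDr.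
  apply: ler_sum => N _; rewrite ler_wpM2l ?bump_weight_ge0 //.
  rewrite lef_pV2 ?posrE ?ltr_wpDr // lerD2l; apply: s_homo; exact: le_truncn.
have small (x : F) (f : F -> F) : 0 <= x -> (forall t, 0 <= t -> 0 <= f t) ->
    (forall T, exists t0, forall t, t0 <= t -> T <= f t) ->
    x / (1 + f t) @[t --> +oo] --> 0.
  move=> x0 f0 fl; apply/cvgr0Pnorm_le => e e0.
  have [t0 t0P] := fl (x / e); near=> t.
  have tp : 0 <= t by near: t; exact: nbhs_pinfty_ge.
  have ft := f0 t tp; have f1 : 0 < 1 + f t by rewrite ltr_wpDr.
  have : x / e <= f t by apply: t0P; near: t; apply: nbhs_pinfty_ge; exact: num_real.
  rewrite ler_pdivrMr // => xe.
  rewrite ger0_norm ?divr_ge0 ?(ltW f1) // ler_pdivrMr //; lra.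
have first_term : r / (1 + t) @[t --> +oo] --> 0 by apply: (small r id) => // T; exists T.
suff terms : \sum_(N < (Num.truncn r).+2) bump_weight N r * decay N t @[t --> +oo] --> 0.
  by have H := cvgD first_term terms; rewrite addr0 in H; exact: H.
apply: (@cvg_sum_ord0 _ _ _ _ (fun N t => bump_weight N r * decay N t)) => N.
apply: (small _ (fun t => s N (Num.truncn t))) => [||T]; [exact: bump_weight_ge0|by []|].
have [k0 k0P] := s_large N T; exists k0%:R => t tk; apply: k0P.
by rewrite truncn_ge_nat // (le_trans _ tk).
Unshelve. all: by end_near.
Qed.

Lemma glued_lower r k : 0 <= r ->
  r / (1 + s (Num.truncn r) k) <= glued r k%:R.
Proof.
move=> r0; set N := Num.truncn r.
have NN : (N < N.+2)%N by rewrite ltnS leqnSn.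
have -> : r / (1 + s N k) = r * decay N k%:R by rewrite /decay natrK.
rewrite /glued (bigD1 (Ordinal NN)) //= -/N.
apply: le_trans (_ : bump_weight N r * decay N k%:R <= _).
  rewrite ler_wpM2r ?(ltW (decay_gt0 _ _)) // /bump_weight.
  have rN : r < N.+1%:R by exact: truncnS_gt.
  have Nr : N%:R <= r by rewrite truncn_le.
  clearbody N; case: N rN Nr {NN} => [|N] rN Nr /=.
    by rewrite mul1r subr0 le_max lexx orbT.
  apply: (@le_trans _ _ N.+2%:R); first exact: ltW.
  rewrite ler_peMr // le_max; apply/orP; right; rewrite -natr1 in Nr; lra.
rewrite addrCA lerDl; apply: addr_ge0; first by rewrite divr_ge0 ?addr_ge0.
apply: sumr_ge0 => i _; rewrite mulr_ge0 ?bump_weight_ge0 //.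
exact/ltW/decay_gt0.
Qed.

End Majorant.
End Comparison.

Theorem theorem30 (F : realType) (n m : nat)
    (A : 'M[F]_n) (B : 'M[F]_(n, m)) (Q : 'M[F]_n) (R : 'M[F]_m)
    (n_gt0 : (0 < n)%N) (m_gt0 : (0 < m)%N)
    (stabAB : stabilizable A B) (posQ : sym_posdef Q) (posR : sym_posdef R)
    (eta : nat -> 'M[F]_(m, n) -> F)
    (eta_bounds : forall k K, stabilizing_gains A B K ->
       0 < eta k K <= 1 / lqr_L A B Q R (lqr_J A B Q R K))
    (* For every cost level h, the step sizes on the sublevel set of h are
       bounded below by a non-summable sequence. *)
    (eta_nonsummable : forall h : F, exists2 e : nat -> F,
       forall k K, stabilizing_gains A B K -> lqr_J A B Q R K <= h ->
         e k <= eta k K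
     & series e @ \oo --> +oo) :
  small_disturbance_ISS (stabilizing_gains A B) (lqr_opt_gain A B Q R)
    (fun k K W => K - eta k K *: (lqr_grad A B Q R K + W)).
Proof.
set Ks := lqr_opt_gain A B Q R; set G := stabilizing_gains A B.
pose J := lqr_J A B Q R.
have [GKs MKs] := opt_gain_props n_gt0 m_gt0 posQ posR stabAB.
have [p1 [p2 [d [C [p1_0 p2_0 d0 C0 step]]]]] :=
  perturbed_step n_gt0 m_gt0 posQ posR GKs MKs.
rewrite -/Ks -/J in step.
pose V K := J K - J Ks.
have V0 K : G K -> 0 <= V K by move=> GK; exact: J_gap_ge0.
have levels (N : nat) : exists u : nat -> F,
    (forall k K, G K -> J K <= J Ks + N.+1%:R -> u k <= eta k K) /\
    series u @ \oo --> +oo.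
  by have [u u1 u2] := eta_nonsummable (J Ks + N.+1%:R); exists u.
have [e eP] := choice levels.
(* At cost gaps of at most [N.+1], one undisturbed step multiplies the gap by at
   most [1 - c N * ep N k]; [s N] accumulates these rates. *)
pose ep N k := Num.max 0 (e N k).
have ep0 N k : 0 <= ep N k by rewrite le_max lexx.
pose c (N : nat) := Num.min p1 (p2 / N.+1%:R).
have c0 N : 0 < c N by rewrite lt_min p1_0 divr_gt0.
pose s N k := c N * series (ep N) k.
have sS N k : s N k.+1 = s N k + c N * ep N k.
  by rewrite /s /series /= big_nat_recr //= mulrDr.
have s0 N k : 0 <= s N k.
  by rewrite mulr_ge0 ?(ltW (c0 N)) // /series /= sumr_ge0.
have s_homo N k l : (k <= l)%N -> s N k <= s N l.
  move=> /subnK <-; elim: (l - k)%N => [//|i IH]; apply: le_trans IH _.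
  by rewrite addSn sS lerDl mulr_ge0 // ltW.
have s_large N T : exists k0, forall k, (k0 <= k)%N -> T <= s N k.
  have [_ /cvgryPge/(_ (T / c N))] := eP N.
  move=> [k0 _ k0P]; exists k0 => k kk0; have := k0P k kk0 => /=.
  rewrite ler_pdivrMr // mulrC => H; apply: le_trans H _.
  rewrite ler_wpM2l ?(ltW (c0 N)) // /series /=; apply: ler_sum => i _.
  by rewrite le_max lexx orbT.
exists V, d%:E, (glued s), (fun w => C * w ^+ 2); split.
- split.
  + apply: within_continuous_fro => X GX r r0.
    have [del del0 delP] := J_cont n_gt0 m_gt0 posQ posR GX r0.
    exists del => // Y GY YX; have := delP Y GY YX.
    by rewrite /V /J opprB addrA subrK.
  + by split; rewrite // /V subrr.
  + by move=> K GK KKs; exact: J_gap_pos.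
  + move=> K GK lim; apply/cvgryPgt => T.
    have T0 : 0 <= Num.max 0 (T + J Ks) by rewrite le_max lexx.
    have := J_coercive n_gt0 m_gt0 posQ posR GK lim T0.
    by apply: filterS => k; rewrite gt_max => /andP [_]; rewrite -ltrBrDr.
- by rewrite lte_fin.
- exact: glued_classKL.
- split.
  + apply: continuous_subspaceT => w.
    apply: (@continuousM _ _ (fun=> C) (fun x : F => x ^+ 2)).
      exact: cst_continuous.
    exact: exprn_continuous.
  + move=> w w' [w0 _] [w'0 _] ww'.
    by rewrite ltr_pM2l // ltrXn2r.
  + by rewrite expr0n mulr0.
move=> W [b bW]; set w := linf_norm W; rewrite lte_fin => wd K GK0 KS.
have Ww k : frobenius (W k) <= w.
  by apply: ub_le_sup; [exists b => _ [j _ <-]; exact: bW|exists k].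
have w0 : 0 <= w by apply: le_trans (Ww 0%N); exact: fro_ge0.
(* While the gap exceeds [C * w ^+ 2] it does not increase, so the rates of the level of
   the initial gap apply; below that threshold it remains there. *)
pose r := V (K 0%N); have r0 : 0 <= r := V0 _ GK0; pose N := Num.truncn r.
have main k : G (K k) /\ (V (K k) <= C * w ^+ 2 \/ V (K k) * (1 + s N k) <= r).
  elim: k => [|k [GK IH]].
    by split => //; right; rewrite /s /series /= big_nil mulr0 addr0 mulr1.
  have /andP [eta0] := eta_bounds k _ GK; rewrite -/(J (K k)) => etaL.
  have L0 : 0 < lqr_L A B Q R (J (K k)).
    by rewrite -invr_gt0 -[X in 0 < X]mul1r; exact: lt_le_trans etaL.
  rewrite (ler_pdivlMr _ _ L0) in etaL.
  have [GK' step'] := step _ _ _ _ GK eta0 etaL (Ww k) wd.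
  rewrite -KS in GK' step'; split => //; have v0 := V0 _ GK.
  case: step' => [->|step']; [by left|].
  rewrite -!/(V _) in step'.
  have min0 : 0 <= Num.min (p1 * V (K k)) p2.
    by rewrite le_min mulr_ge0 ?(ltW p1_0) // ltW.
  have V' : V (K k.+1) <= V (K k).
    by apply: le_trans step' _; rewrite lerBlDr lerDl mulr_ge0 // ltW.
  case: IH => [IH|IH]; [by left; exact: le_trans IH|right].
  have Vr : V (K k) <= N.+1%:R.
    apply: (@le_trans _ _ r); last exact/ltW/truncnS_gt.
    by apply: le_trans IH; rewrite ler_peMr // lerDl.
  have eta_e : ep N k <= eta k (K k).
    rewrite ge_max (ltW eta0) /=; have [H _] := eP N; apply: H => //.
    by move: Vr; rewrite /V lerBlDl.
  have cV : c N * V (K k) <= Num.min (p1 * V (K k)) p2.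
    rewrite le_min; apply/andP; split.
      by rewrite ler_wpM2r // ge_min lexx.
    apply: (@le_trans _ _ (p2 / N.+1%:R * V (K k))).
      by rewrite ler_wpM2r // ge_min lexx orbT.
    by rewrite mulrAC ler_pdivrMr // ler_wpM2l // ltW.
  have eV : ep N k * (c N * V (K k)) <= eta k (K k) * Num.min (p1 * V (K k)) p2.
    by rewrite ler_pM // mulr_ge0 // ltW.
  (* Passing from a product of factors [1 - x] to the reciprocal of a sum:
     [(1 - x) * (1 + s + x) <= 1 + s]. *)
  rewrite sS; set x := c N * ep N k.
  have x0 : 0 <= x by rewrite mulr_ge0 // ltW.
  have Vx : V (K k.+1) <= V (K k) * (1 - x).
    apply: le_trans step' _.
    have -> : V (K k) * (1 - x) = V (K k) - ep N k * (c N * V (K k)) by rewrite /x; ring.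
    by rewrite lerD2l lerN2.
  apply: le_trans IH; apply: (@le_trans _ _ (V (K k) * (1 - x) * (1 + (s N k + x)))).
    by rewrite ler_wpM2r // addr_ge0 // addr_ge0.
  rewrite -mulrA ler_wpM2l //.
  have xs : 0 <= x * s N k by rewrite mulr_ge0.
  by have xx := sqr_ge0 x; rewrite (_ : _ * _ = 1 + s N k - x * s N k - x ^+ 2); [lra|ring].
move=> k; have [GK HK] := main k; split => //.
have lower := glued_lower s0 k r0; rewrite -/N in lower.
have s1 : 0 < 1 + s N k by rewrite ltr_wpDr.
have lower0 : 0 <= r / (1 + s N k) by rewrite divr_ge0 // ltW.
have g0 : 0 <= C * w ^+ 2 by rewrite mulr_ge0 ?sqr_ge0 // ltW.
case: HK => HK; first by apply: le_trans HK _; rewrite lerDr (le_trans lower0).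
rewrite -ler_pdivlMr // in HK; apply: le_trans HK _.
by apply: le_trans lower _; rewrite lerDl.
Qed.
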